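(* Let $f(x)=\frac1N\sum_{i=1}^N f(x,i)$, $x\in\mathbb{R}^n$, where each $f(\cdot,i):\mathbb{R}^n\to\mathbb{R}$ is continuously differentiable and bounded from below and each $\nabla f(\cdot,i)$ is Lipschitz continuous with parameter $L>0$. Let $\{X^t\}_{t\ge1}$ be the stochastic process generated by the random reshuffling method on the probability space $(\Omega,\mathcal{F},\mathbb{P})$ with step sizes $\alpha_t=\frac{\alpha}{(t+\beta)^\gamma}$, where $\alpha>0$, $\beta\ge0$, $\gamma\in(\frac12,1]$. Assume: (i) $\sup_t\|X^t\|<\infty$ almost surely; (ii) there is an event $\mathcal{K}\in\mathcal{F}$ with $\mathbb{P}(\mathcal{K})=1$ such that $f$ satisfies the KL inequality at every $\bar x\in\bigcup_{\omega\in\mathcal{K}}\mathcal{C}(\omega)$, where each respective desingularizing function can be selected from the class $\mathcal{L}$ of {\L}ojasiewicz functions. Then $\{X^t\}_{t\ge1}$ almost surely converges to a $\mathrm{crit}(f)$-valued random vector $X^*:\Omega\to\mathrm{crit}(f)$. Furthermore, let $\Theta:\Omega\to[0,1)$ denote the function that maps each sample $\omega\in\mathcal{K}$ to the KL exponent of $f$ at $X^*(\omega)$ and let $C:\Omega\to[0,\infty)$ be the corresponding function of KL constants. Then the event $$\mathcal{G}:=\Big\{\omega\in\Omega:\ \limsup_{t\to\infty}\ t^{\Psi(\omega)}\cdot\|X^t(\omega)-X^*(\omega)\|<\infty\Big\}$$ occurs almost surely, where the rate function $\Psi:\Omega\to[0,\infty)$ is given by $$\Psi(\omega):=\begin{cases}2\gamma-1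 & \text{if } 0\le\Theta(\omega)<\frac{\gamma}{3\gamma-1}\text{ and }\gamma\in(\frac12,1),\\[2pt] \frac{(1-\Theta(\omega))(1-\gamma)}{2\Theta(\omega)-1} & \text{if }\frac{\gamma}{3\gamma-1}\le\Theta(\omega)<1\text{ and }\gamma\in(\frac12,1),\\[2pt] 1 & \text{if }\Theta(\omega)\in[0,\frac12],\ \gamma=1,\text{ and }\alpha>\frac{8C^2(\omega)}{N},\\[2pt] 0 & \text{otherwise.}\end{cases}$$
   Context: Random reshuffling method: given a (deterministic) $x^0\in\mathbb{R}^n$ and step sizes $\alpha_t>0$, at each iteration $t=1,2,\dots$ a permutation $\sigma^t=(\sigma^t_1,\dots,\sigma^t_N)$ of $\{1,\dots,N\}$ is drawn, i.i.d. uniformly over the set $\Lambda$ of all permutations; set $\tilde x^t_0=x^{t-1}$, $\tilde x^t_i=\tilde x^t_{i-1}-\alpha_t\nabla f(\tilde x^t_{i-1},\sigma^t_i)$ for $i=1,\dots,N$, and $x^t=\tilde x^t_N$. Stochastic model: $\Omega=\Lambda^\infty$ is the set of all sequences $\omega=(\omega_1,\omega_2,\dots)$ with $\omega_i\in\Lambda$, equipped with its natural (product) $\sigma$-algebra $\mathcal{F}$ and the probability $\mathbb{P}$ under which the $\omega_t$ are i.i.d. uniform; $\{X^t(\omega)\}_{t\ge1}$ is the sequence of iterates $x^t$ obtained with $\sigma^t=\omega_t$. $\mathcal{C}(\omega)=\{x\in\mathbb{R}^n:\ \text{there is a subsequence }\{t_\ell\}_\ell\text{ with }X^{t_\ell}(\omega)\to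 x\}$, and $\mathrm{crit}(f)=\{x\in\mathbb{R}^n:\nabla f(x)=0\}$. The class of {\L}ojasiewicz functions is $\mathcal{L}=\{\varrho:[0,\infty)\to[0,\infty):\ \exists\,c>0,\ \theta\in[0,1)\text{ with }\varrho(s)=cs^{1-\theta}\}$. KL inequality at $\bar x$ with desingularizing function $\varrho(s)=cs^{1-\theta}\in\mathcal{L}$: there are $\eta\in(0,\infty]$ and a neighborhood $U$ of $\bar x$ such that $\varrho'(|f(x)-f(\bar x)|)\cdot\|\nabla f(x)\|\ge1$, i.e. $|f(x)-f(\bar x)|^\theta\le c(1-\theta)\|\nabla f(x)\|$, for all $x\in U$ with $0<|f(x)-f(\bar x)|<\eta$. In this case $\theta$ is called the KL exponent of $f$ at $\bar x$ and $c$ the corresponding KL constant. ''$\mathcal{G}$ occurs almost surely'' means that $\mathcal{G}$ contains some $\mathcal{E}\in\mathcal{F}$ with $\mathbb{P}(\mathcal{E})=1$. The values of $\Theta$ and $C$ on the null set of samples outside $\mathcal{K}$ or where $X^t(\omega)$ does not converge to $X^*(\omega)$ are irrelevant. *)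

(* Defs.v *)
From HB Require Import structures.
From mathcomp Require Import all_boot all_order all_algebra all_fingroup finmap.
From mathcomp Require Import all_classical all_reals all_analysis.

Set Implicit Arguments.
Unset Strict Implicit.
Unset Printing Implicit Defensive.

Import Order.TTheory GRing.Theory Num.Theory.
Import numFieldNormedType.Exports.

Local Open Scope classical_set_scope.
Local Open Scope ring_scope.

Section Euclidean.
Context {R : realType} {n : nat}.
Implicit Types (f : 'rV[R]_n -> R) (x : 'rV[R]_n).

(* The library norm on 'rV[R]_n is the max norm: it induces the usual topology,
   but all quantitative statements below need the Euclidean norm. *)
Definition enorm x : R := Num.sqrt (\sum_(j < n) x 0 j ^+ 2).

Definition grad f x : 'rV[R]_n := \row_(j < n) 'D_(delta_mx 0 j) f x.

Definition C1 f : Prop :=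
  (forall x, differentiable f x) /\ continuous (grad f).

Definition bounded_from_below f : Prop := exists m : R, forall x, m <= f x.

Definition grad_lipschitz (L : R) f : Prop :=
  forall x y, enorm (grad f x - grad f y) <= L * enorm (x - y).

Definition crit f : set 'rV[R]_n := [set x | grad f x = 0].

Definition borel_rV : set (set 'rV[R]_n) := @open 'rV[R]_n.

End Euclidean.

Section KurdykaLojasiewicz.
Context {R : realType} {n : nat}.
Implicit Types (f : 'rV[R]_n -> R) (rho : R -> R) (xbar : 'rV[R]_n).

Definition lojasiewicz (c theta : R) : R -> R := fun s => c * s `^ (1 - theta).

(* rho is only used, and only differentiated, at points s > 0. *)
Definition KL_inequality f rho xbar : Prop :=
  exists eta : \bar R, (0 < eta)%E /\
  exists2 U : set 'rV[R]_n, nbhs xbar U &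
    forall x, U x -> 0 < `|f x - f xbar| -> (`|f x - f xbar|%:E < eta)%E ->
      1 <= derive1 rho `|f x - f xbar| * enorm (grad f x).

Definition KL_exponent_constant f xbar (theta c : R) : Prop :=
  [/\ 0 < c, 0 <= theta < 1 & KL_inequality f (lojasiewicz c theta) xbar].

End KurdykaLojasiewicz.

HB.instance Definition _ (T : finType) := isPointed.Build (perm_type T) 1%g.

Section SampleSpace.
Variable N : nat.

Definition cylinders : set (set (nat -> 'S_N)) :=
  [set [set w | B (w t)] | t in [set: nat] & B in [set: set 'S_N]].

(* w t is the permutation omega_(t+1) of the paper: draws are indexed from 0. *)
Definition Omega := g_sigma_algebraType cylinders.

Definition iid_uniform {R : realType} (P : probability Omega R) : Prop :=
  (forall (t : nat) (s : 'S_N),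
     P [set w : Omega | w t = s] = (#|{: 'S_N}|%:R^-1)%:E) /\
  (forall (J : {fset nat}) (B : nat -> set 'S_N),
     P (\bigcap_(t in [set` J]) [set w : Omega | B t (w t)]) =
     (\prod_(t <- J) P [set w : Omega | B t (w t)])%E).

End SampleSpace.

Section RandomReshuffling.
Context {R : realType} {n N : nat}.
Variables (fi : 'I_N -> 'rV[R]_n -> R) (step : nat -> R) (x0 : 'rV[R]_n).

Definition average : 'rV[R]_n -> R :=
  fun x => N%:R^-1 * \sum_(i < N) fi i x.

Definition epoch (a : R) (s : 'S_N) (x : 'rV[R]_n) : 'rV[R]_n :=
  foldl (fun y i => y - a *: grad (fi (s i)) y) x (enum 'I_N).

Fixpoint iterate (t : nat) (w : Omega N) : 'rV[R]_n :=
  if t is t'.+1 then epoch (step t) (w t') (iterate t' w) else x0.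

End RandomReshuffling.

Definition step_size {R : realType} (alpha beta gamma : R) (t : nat) : R :=
  alpha / (t%:R + beta) `^ gamma.

Definition accumulation_points {R : realType} {n : nat} (x : nat -> 'rV[R]_n) :
    set 'rV[R]_n :=
  [set y | exists tl : nat -> nat,
     {homo tl : k l / (k < l)%N} /\ x (tl k) @[k --> \oo] --> y].

Definition rate {R : realType} (N : nat) (alpha gamma theta c : R) : R :=
  if [&& 0 <= theta, theta < gamma / (3 * gamma - 1), 2^-1 < gamma & gamma < 1]
  then 2 * gamma - 1
  else if [&& gamma / (3 * gamma - 1) <= theta, theta < 1, 2^-1 < gamma
           & gamma < 1]
  then (1 - theta) * (1 - gamma) / (2 * theta - 1)
  else if [&& 0 <= theta, theta <= 2^-1, gamma == 1 & 8 * c ^+ 2 / N%:R < alpha]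
  then 1
  else 0.

(* Main.v *)
Require Import Defs.
From HB Require Import structures.
From mathcomp Require Import all_boot all_order all_algebra all_fingroup finmap.
From mathcomp Require Import all_classical all_reals all_analysis.
From mathcomp Require Import ring lra.

(* Everything except measurability is pathwise. On a bounded trajectory one epoch
   is a gradient step on f of length N a_t with an O(a_t^2) error, whatever the
   permutation, so f(x_t) decreases by (N/2) a_t |grad f(x_t)|^2 up to O(a_t^3).
   Adding a multiple u_t of (t + 1 + beta)^(1 - 3 gamma), which absorbs the tail
   of these errors, makes y_t = f(x_t) - f(xbar) + u_t nonincreasing, and y_t
   tends to 0 for any accumulation point xbar. Near xbar the KL inequality with
   exponent theta (raised to at least gamma / (3 gamma - 1)) bounds the step
   length by the decrease of

     K1 y_t^(1 - theta) + K2 (t + 1 + beta)^(1 - 2 gamma),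

   so the trajectory is trapped near xbar, converges to it, and its distance to
   xbar is at most this expression. The rate then follows from the recursion
   y_(t+1) <= y_t - b t^(-gamma) y_t^(2 theta) + (noise). *)

Set Implicit Arguments.
Unset Strict Implicit.
Unset Printing Implicit Defensive.

Import Order.TTheory GRing.Theory Num.Theory.
Import numFieldNormedType.Exports.

Local Open Scope classical_set_scope.
Local Open Scope ring_scope.

(** * Inequalities for real powers and decay of recursive sequences *)

Section RealPowers.
Context {R : realType}.
Implicit Types (x y s u v p q r : R).

Lemma le_powR_mid x r : 0 <= x <= 1 -> 0 < r <= 1 -> x <= x `^ r.
Proof.
move=> /andP[x0 x1] /andP[r0 r1]; move: x0; rewrite le_eqVlt => /predU1P[<-|x0].
  by rewrite powR0 ?gt_eqF.
by rewrite ger1_powR// x0.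
Qed.

(** After division by u + v both terms lie in [0, 1], where raising to a power r <= 1 does not
    decrease; the two fractions add up to 1. *)
Lemma powR_subadditive u v r : 0 <= u -> 0 <= v -> 0 < r <= 1 ->
  (u + v) `^ r <= u `^ r + v `^ r.
Proof.
move=> u0 v0 /[dup] r01 /andP[r0 r1].
have [uv0|uv0] := eqVneq (u + v) 0.
  by rewrite uv0 powR0 ?gt_eqF// addr_ge0 ?powR_ge0.
have s0 : 0 < u + v by rewrite lt_def uv0 addr_ge0.
have E w : 0 <= w -> w <= u + v -> w / (u + v) * (u + v) `^ r <= w `^ r.
  move=> w0 ws; rewrite -[in leRHS](divfK uv0 w) powRM ?divr_ge0 ?(ltW s0)//.
  rewrite ler_wpM2r ?powR_ge0// le_powR_mid// divr_ge0 ?(ltW s0)//=.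
  by rewrite ler_pdivrMr// mul1r.
have := lerD (E u u0 _) (E v v0 _).
by rewrite -!mulrDl divff// mul1r; apply; rewrite ?lerDl ?lerDr.
Qed.

(** Concavity of z^(1 - r), with the derivative at [y] multiplied out so that [y = 0] is allowed. It
    is Young's inequality for y^r and x^(1 - r) with exponents 1/r and 1/(1 - r). *)
Lemma powR_concave_diff y x r : 0 <= x -> 0 <= y -> 0 < r < 1 ->
  (1 - r) * (y - x) <= y `^ r * (y `^ (1 - r) - x `^ (1 - r)).
Proof.
move=> x0 y0 /andP[r0 r1].
have r1' : 0 < 1 - r by rewrite subr_gt0.
have rr1 : r + (1 - r) = 1 by ring.
have := @conjugate_powR R (y `^ r) (x `^ (1 - r)) r^-1 (1 - r)^-1
  (powR_ge0 _ _) (powR_ge0 _ _).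
rewrite !invr_gt0 !invrK -!powRrM !mulfV ?gt_eqF// !powRr1// rr1.
move=> /(_ r0 r1' erefl) H.
rewrite [leRHS]mulrBr -powRD rr1 ?oner_eq0// powRr1//; lra.
Qed.

(** A Bernoulli inequality: write (1 + 1/t)^(-s) as an exponential and use e^z >= 1 + z and ln (1 +
    z) <= z. *)
Lemma powRN_succ_ge (t s : R) : 0 < t -> 0 <= s ->
  t `^ (- s) * (1 - s / t) <= (t + 1) `^ (- s).
Proof.
move=> t0 s0.
have t1 : 0 < t + 1 by rewrite addr_gt0.
have -> : (t + 1) `^ (- s) = t `^ (- s) * (1 + t^-1) `^ (- s).
  rewrite -powRM ?ltW// ?addr_gt0 ?invr_gt0//.
  by congr (_ `^ _); field; rewrite gt_eqF.
rewrite ler_wpM2l ?powR_ge0// /powR gt_eqF ?addr_gt0 ?invr_gt0//.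
apply: le_trans (expR_ge1Dx _); rewrite lerD2l mulNr lerN2 ler_wpM2l//.
by apply: le_ln1Dx; rewrite (lt_trans _ (_ : 0 < _)) ?invr_gt0// oppr_lt0.
Qed.

Lemma powRN_succ_diff_le (t p : R) : 0 < t -> 0 <= p ->
  t `^ (- p) - (t + 1) `^ (- p) <= p * t `^ (- (p + 1)).
Proof.
move=> t0 p0; have := powRN_succ_ge t0 p0.
rewrite opprD powRD ?(gt_eqF t0) ?implybT// powR_inv1 ?(ltW t0)//.
lra.
Qed.

(** The same Bernoulli argument based at t + 1; the factor 2^(-(r + 1)) pays for returning to base
    [t] through t + 1 <= 2 t. Its use is to dominate summable powers by telescoping differences. *)
Lemma powRN_succ_diff_ge (t r : R) : 1 <= t -> 0 <= r ->
  r * 2 `^ (- (r + 1)) * t `^ (- (r + 1)) <= t `^ (- r) - (t + 1) `^ (- r).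
Proof.
move=> t1 r0.
have t0 : 0 < t by rewrite (lt_le_trans _ t1).
have s0 : 0 < t + 1 by rewrite addr_gt0.
have H : (t + 1) `^ (- r) * (1 + r / (t + 1)) <= t `^ (- r).
  have -> : t `^ (- r) = (t + 1) `^ (- r) * (1 - (t + 1)^-1) `^ (- r).
    rewrite -powRM ?ltW// ?subr_gt0 ?invf_lt1 ?ltrDr//.
    by congr (_ `^ _); field; rewrite gt_eqF.
  rewrite ler_wpM2l ?powR_ge0// /powR.
  have iv : 0 < 1 - (t + 1)^-1 by rewrite subr_gt0 invf_lt1 ?ltrDr.
  rewrite (gt_eqF iv); apply: le_trans (expR_ge1Dx _).
  rewrite lerD2l mulNr -mulrN ler_wpM2l// lerNr.
  by apply: le_ln1Dx; rewrite ltrN2 invf_lt1 ?ltrDr.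
have H2 : 2 `^ (- (r + 1)) * t `^ (- (r + 1)) <= (t + 1) `^ (- (r + 1)).
  rewrite -powRM ?(ltW t0)// !powRN lef_pV2 ?posrE ?powR_gt0 ?mulr_gt0//.
  rewrite ge0_ler_powR ?nnegrE ?addr_ge0 ?mulr_ge0 ?(ltW t0)//.
  by rewrite mulr_natl mulr2n lerD2l.
rewrite -mulrA.
apply: le_trans (ler_wpM2l r0 H2) _.
rewrite opprD powRD ?(gt_eqF s0) ?implybT// powR_inv1 ?(ltW s0)//; lra.
Qed.

(* This turns a decrease [m a g^2] of [y] into control of the step length [a g]
   by the decrease of [y^(1 - r)]: if [g <= v] the last term suffices, and
   otherwise the Lojasiewicz bound reads [y^r <= (c + 1) g]. *)
Lemma powR_step_le (y x c r a g v m : R) :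
  0 <= x -> 0 <= y -> 0 < r < 1 -> 0 <= a -> 0 < m -> 0 < c -> 0 <= g ->
  0 <= v ->
  x <= y - m * a * g ^+ 2 -> y `^ r <= c * g + v ->
  a * g <= (c + 1) / (m * (1 - r)) * (y `^ (1 - r) - x `^ (1 - r)) + a * v.
Proof.
move=> x0 y0 r01 a0 m0 c0 g0 v0 xy yr.
have := powR_concave_diff x0 y0 r01; move: r01 => /andP[r0 r1].
set D := y `^ _ - _.
have xy' : x <= y by rewrite (le_trans xy)// gerBl !mulr_ge0 ?exprn_ge0// ltW.
have D0 : 0 <= D.
  by rewrite subr_ge0 ge0_ler_powR ?nnegrE ?subr_ge0// ltW.
have r1' : 0 < 1 - r by rewrite subr_gt0.
move=> H.
have C0 : 0 <= (c + 1) / (m * (1 - r)) * D.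
  rewrite mulr_ge0// divr_ge0 ?mulr_ge0 ?(ltW m0) ?(ltW r1')//.
  by rewrite addr_ge0// ltW.
have [gv|vg] := leP g v; first by rewrite (le_trans (ler_wpM2l a0 gv))// lerDr.
apply: (@le_trans _ _ ((c + 1) / (m * (1 - r)) * D)); last first.
  by rewrite lerDl mulr_ge0.
have g0' : 0 < g by rewrite (le_lt_trans v0).
rewrite mulrAC ler_pdivlMr ?mulr_gt0// -(ler_pM2r g0').
apply: (@le_trans _ _ ((1 - r) * (y - x))).
  have -> : a * g * (m * (1 - r)) * g = (1 - r) * (m * a * g ^+ 2) by ring.
  by rewrite ler_pM2l//; lra.
apply: le_trans H _.
have -> : (c + 1) * D * g = (c + 1) * g * D by ring.
by rewrite ler_wpM2r// (le_trans yr)// mulrDl mul1r lerD2l ltW.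
Qed.

(** A Chung-type lemma. The balance [g + q * p = 1 + p] gives all corrections to A tau^(-p) the same
    order tau^(-(p + 1)), so the induction closes once p A + e <= rho b A^q. A large A achieves this
    if q > 1; if q = 1 it requires b > p. *)
Lemma powR_recursion_decay (y : R^nat) (t0 p q g b e : R) (T : nat) :
  0 < t0 -> 0 < p -> 0 <= e -> 0 < b -> g + q * p = 1 + p -> 1 <= q ->
  (1 < q \/ p < b) ->
  (forall t, (T <= t)%N -> 0 <= y t) ->
  (forall t, (T <= t)%N -> y t.+1 <= y t) ->
  (forall t, (T <= t)%N -> y t.+1 <= y t
     - b * (t%:R + t0) `^ (- g) * y t `^ q + e * (t%:R + t0) `^ (- (p + 1))) ->
  exists2 A, 0 <= A & exists S, forall t, (S <= t)%N ->
    y t <= A * (t%:R + t0) `^ (- p).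
Proof.
move=> t00 p0 e0 b0 gqp q1 qb y0 yn yr.
have q0 : 0 < q by rewrite (lt_le_trans _ q1).
(* The slack [rho < 1] pays for replacing (tau + 1)^(-q p) by tau^(-q p) below. For q = 1 it is the
   midpoint of p / b and 1, so that rho b still exceeds p. *)
have [rho [A0 [/andP[rho0 rho1] A00 HA]]] : exists rho A0 : R,
    [/\ 0 < rho < 1, 0 <= A0 &
     forall A, A0 <= A -> p * A + e <= rho * b * A `^ q].
  have [q1'|q1'] := ltP 1 q.
    set k := (p + e) / (2^-1 * b).
    have k0 : 0 <= k.
      by rewrite divr_ge0 ?mulr_ge0 ?addr_ge0 ?invr_ge0 ?(ltW b0) ?(ltW p0).
    exists 2^-1, (Num.max 1 (k `^ (q - 1)^-1)); split; first lra.
      by rewrite le_max ler01.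
    move=> A; rewrite ge_max => /andP[A1 Ak].
    have A0 : 0 < A by rewrite (lt_le_trans _ A1).
    have kA : k <= A `^ (q - 1).
      have -> : k = (k `^ (q - 1)^-1) `^ (q - 1).
        by rewrite -powRrM mulVf ?powRr1// gt_eqF// subr_gt0.
      by rewrite ge0_ler_powR ?nnegrE ?powR_ge0 ?(ltW A0) ?subr_ge0.
    rewrite -(mulr_powRB1 (ltW A0) q0).
    apply: (@le_trans _ _ (2^-1 * b * (A * k))); last first.
      by rewrite ler_wpM2l ?mulr_ge0 ?invr_ge0 ?(ltW b0)// ler_wpM2l ?(ltW A0).
    have -> : 2^-1 * b * (A * k) = (p + e) * A.
      by rewrite /k; field; rewrite gt_eqF.
    by rewrite mulrDl lerD2l ler_peMr.
  have pb : p < b by case: qb => //; lra.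
  have -> : q = 1 by apply/le_anti; rewrite q1 q1'.
  have pb1 : p / b < 1 by rewrite ltr_pdivrMr ?mul1r.
  have pb0 : 0 < p / b by rewrite divr_gt0.
  have rb : (p / b + 1) / 2 * b - p = (b - p) / 2 by field; rewrite gt_eqF.
  exists ((p / b + 1) / 2), (e / ((b - p) / 2)); split; first lra.
    by rewrite divr_ge0// divr_ge0// subr_ge0 ltW.
  move=> A; rewrite ler_pdivrMr ?divr_gt0 ?subr_gt0// -rb => HA.
  rewrite powRr1; first lra.
  move: HA; rewrite rb => HA.
  have : 0 <= A * ((b - p) / 2) by apply: le_trans HA.
  by rewrite pmulr_lge0// divr_gt0// subr_gt0.
(* From [S] on, 1 - q p / tau is at least [rho]; the second entry of the maximum defining [A] starts
   the induction at [S]. *)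
pose S := maxn T (Num.truncn (q * p / (1 - rho))).+1.
have tau0 t : 0 < t%:R + t0 by rewrite ltr_wpDl.
pose A := Num.max A0 (y S / (S%:R + t0) `^ (- p)).
have AA0 : A0 <= A by rewrite le_max lexx.
have A_ge0 : 0 <= A by apply: le_trans AA0.
exists A => //; exists S => t St; rewrite -(subnK St); elim: (t - S)%N => [|k].
  by rewrite add0n -ler_pdivrMr ?powR_gt0// le_max lexx orbT.
rewrite addSn; set t' := (k + S)%N => IH.
have St' : (S <= t')%N by exact: leq_addl.
have Tt : (T <= t')%N by exact: leq_trans (leq_maxl _ _) St'.
have -> : t'.+1%:R + t0 = (t'%:R + t0) + 1 by rewrite -natr1 addrAC.
set tau := t'%:R + t0 in IH *; have tp : 0 < tau by exact: tau0.
(* Below the target [y] stays there by monotonicity, so the recursion is only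
   needed when [y t'] is comparable to [A tau^(-p)]; in particular the map
   [z |-> z - b tau^(-g) z^q] need not be monotone. *)
have [yl|yg] := leP (y t') (A * (tau + 1) `^ (- p)).
  by rewrite (le_trans (yn _ Tt)).
apply: le_trans (yr _ Tt) _; rewrite -/tau.
have H1 : rho * tau `^ (- (q * p)) <= (tau + 1) `^ (- (q * p)).
  apply: le_trans (powRN_succ_ge tp _); last by rewrite mulr_ge0 ?ltW.
  have : q * p / (1 - rho) <= tau.
    apply: (@le_trans _ _ t'%:R); last by rewrite lerDl ltW.
    apply: (@le_trans _ _ (Num.truncn (q * p / (1 - rho))).+1%:R).
      by apply/ltW/truncnS_gt.
    by rewrite ler_nat; exact: leq_trans (leq_maxr _ _) St'.
  rewrite ler_pdivrMr ?subr_gt0// => Hq.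
  rewrite [rho * _]mulrC ler_wpM2l ?powR_ge0//.
  have : q * p / tau <= 1 - rho by rewrite ler_pdivrMr// [leRHS]mulrC.
  lra.
have H2 : A `^ q * (rho * tau `^ (- (q * p))) <= y t' `^ q.
  apply: (@le_trans _ _ ((A * (tau + 1) `^ (- p)) `^ q)).
    rewrite powRM ?powR_ge0// ler_wpM2l ?powR_ge0//.
    by rewrite -powRrM mulNr [p * q]mulrC.
  by rewrite ge0_ler_powR ?nnegrE ?mulr_ge0 ?powR_ge0 ?y0 ?(ltW q0)// ltW.
have H3 : tau `^ (- g) * tau `^ (- (q * p)) = tau `^ (- (p + 1)).
  by rewrite -powRD ?(gt_eqF tp) ?implybT//; congr (_ `^ _); lra.
have H4 : b * tau `^ (- g) * (A `^ q * (rho * tau `^ (- (q * p))))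
          <= b * tau `^ (- g) * y t' `^ q.
  by rewrite ler_wpM2l// mulr_ge0 ?powR_ge0 ?ltW.
have H5 : b * tau `^ (- g) * (A `^ q * (rho * tau `^ (- (q * p)))) =
          rho * b * A `^ q * tau `^ (- (p + 1)) by rewrite -H3; ring.
have H6 := ler_wpM2r (powR_ge0 tau (- (p + 1))) (HA _ AA0).
have H7 := ler_wpM2l A_ge0 (powRN_succ_diff_le tp (ltW p0)).
move: H4 H6 H7 IH; rewrite H5 mulrDl mulrBr.
set X := rho * b * _ * _; set Y := b * _ * _; set Z := tau `^ (- (p + 1)).
have -> : A * (p * Z) = p * A * Z by ring.
lra.
Qed.

Lemma powRN_shift_cvg0 (t0 s : R) : 0 <= t0 -> 0 < s -> forall e : R, 0 < e ->
  exists S, forall t : nat, (S <= t)%N -> (t%:R + t0) `^ (- s) < e.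
Proof.
move=> t00 s0 e e0; exists (Num.truncn (e^-1 `^ s^-1)).+1 => t St.
have tp : 0 < t%:R :> R by rewrite ltr0n (leq_trans _ St).
have tau0 : 0 < t%:R + t0 by rewrite ltr_wpDr.
rewrite powRN -[ltRHS]invrK ltf_pV2 ?posrE ?invr_gt0 ?powR_gt0//.
have -> : e^-1 = (e^-1 `^ s^-1) `^ s.
  by rewrite -powRrM mulVf ?powRr1 ?invr_ge0 ?(ltW e0)// gt_eqF.
rewrite gt0_ltr_powR ?nnegrE ?powR_ge0 ?(ltW tau0)//.
apply: (lt_le_trans (truncnS_gt _)).
by rewrite (@le_trans _ _ t%:R) ?ler_nat// lerDl.
Qed.

End RealPowers.

(** * Euclidean norm, inner product and the descent inequality *)

Section EuclideanNorm.
Context {R : realType} {n : nat}.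
Implicit Types (f : 'rV[R]_n -> R) (x y z : 'rV[R]_n) (a : R).

Definition dotv x y : R := \sum_(j < n) x 0 j * y 0 j.

Lemma dotvC x y : dotv x y = dotv y x.
Proof. by apply: eq_bigr => j _; rewrite mulrC. Qed.

Lemma dotvDr x y z : dotv x (y + z) = dotv x y + dotv x z.
Proof. by rewrite -big_split; apply: eq_bigr => j _; rewrite mxE mulrDr. Qed.

Lemma dotvDl x y z : dotv (y + z) x = dotv y x + dotv z x.
Proof. by rewrite dotvC dotvDr !(dotvC x). Qed.

Lemma dotvZr a x y : dotv x (a *: y) = a * dotv x y.
Proof. by rewrite mulr_sumr; apply: eq_bigr => j _; rewrite mxE mulrCA. Qed.

Lemma dotvZl a x y : dotv (a *: x) y = a * dotv x y.
Proof. by rewrite dotvC dotvZr dotvC. Qed.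

Lemma dotvNl x y : dotv (- x) y = - dotv x y.
Proof. by rewrite -scaleN1r dotvZl mulN1r. Qed.

Lemma dotvv_ge0 x : 0 <= dotv x x.
Proof. by apply: sumr_ge0 => j _; rewrite -expr2 sqr_ge0. Qed.

Lemma enorm_ge0 x : 0 <= enorm x.
Proof. exact: sqrtr_ge0. Qed.

Lemma sqr_enorm x : enorm x ^+ 2 = dotv x x.
Proof.
have E : \sum_(j < n) x 0 j ^+ 2 = dotv x x.
  by apply: eq_bigr => j _; rewrite expr2.
by rewrite /enorm E sqr_sqrtr// dotvv_ge0.
Qed.

Lemma enormZ a x : enorm (a *: x) = `|a| * enorm x.
Proof.
apply/eqP; rewrite -(eqrXn2 (n := 2))// ?enorm_ge0 ?mulr_ge0 ?enorm_ge0//.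
by rewrite exprMn !sqr_enorm dotvZr dotvZl mulrA real_normK ?num_real// expr2.
Qed.

Lemma enormN x : enorm (- x) = enorm x.
Proof. by rewrite -scaleN1r enormZ normrN1 mul1r. Qed.

Lemma enorm0 : enorm (0 : 'rV[R]_n) = 0.
Proof. by rewrite -(scale0r 0) enormZ normr0 mul0r. Qed.

Lemma coord_le_enorm x j : `|x 0 j| <= enorm x.
Proof.
rewrite -sqrtr_sqr ler_wsqrtr// (bigD1 j)//= lerDl.
by apply: sumr_ge0 => i _; rewrite sqr_ge0.
Qed.

Lemma enorm_eq0 x : enorm x = 0 -> x = 0.
Proof.
move=> x0; apply/rowP => j; rewrite mxE; apply/normr0_eq0/le_anti.
by rewrite normr_ge0 andbT -x0 coord_le_enorm.
Qed.

(** Cauchy-Schwarz, from expanding the square of |y| x - |x| y; zero vectors are split off first so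
    that the product of the norms can be cancelled. *)
Lemma dotv_le x y : dotv x y <= enorm x * enorm y.
Proof.
have [/enorm_eq0 ->|x0] := eqVneq (enorm x) 0.
  rewrite enorm0 mul0r /dotv big1// => j _; by rewrite mxE mul0r.
have [/enorm_eq0 ->|y0] := eqVneq (enorm y) 0.
  rewrite enorm0 mulr0 /dotv big1// => j _; by rewrite mxE mulr0.
have {}x0 : 0 < enorm x by rewrite lt_def x0 enorm_ge0.
have {}y0 : 0 < enorm y by rewrite lt_def y0 enorm_ge0.
have := dotvv_ge0 (enorm y *: x + (- enorm x) *: y).
rewrite dotvDr !dotvDl !dotvZr !dotvZl -!sqr_enorm (dotvC y x).
set a := enorm x in x0 *; set b := enorm y in y0 *; set d := dotv x y => H.
have {}H : 0 <= a * b * (a * b - d) by nra.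
by rewrite -subr_ge0; rewrite pmulr_rge0// mulr_gt0 in H.
Qed.

Lemma enormD x y : enorm (x + y) <= enorm x + enorm y.
Proof.
rewrite -(ler_pXn2r (n := 2)) ?nnegrE ?addr_ge0 ?enorm_ge0//.
rewrite sqr_enorm dotvDr !dotvDl -!sqr_enorm (dotvC y x).
have := dotv_le x y; nra.
Qed.

Lemma enorm_sub_ge x y : enorm x - enorm y <= enorm (x - y).
Proof. by rewrite lerBlDr; have := enormD (x - y) y; rewrite subrK. Qed.

Lemma enormBC x y : enorm (x - y) = enorm (y - x).
Proof. by rewrite -enormN opprB. Qed.

Lemma enorm_sum (I : Type) (r : seq I) (F : I -> 'rV[R]_n) :
  enorm (\sum_(i <- r) F i) <= \sum_(i <- r) enorm (F i).
Proof.
elim/big_rec2 : _ => [|i u v _ H]; first by rewrite enorm0.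
by rewrite (le_trans (enormD _ _))// lerD2l.
Qed.

Lemma norm_le_enorm x : `|x| <= enorm x.
Proof.
rewrite [leLHS]/Num.norm/= mx_normrE; apply/bigmax_leP; split.
  exact: enorm_ge0.
by move=> [i j] _ /=; rewrite (ord1 i) coord_le_enorm.
Qed.

Lemma coord_le_norm x j : `|x 0 j| <= `|x|.
Proof.
rewrite [leRHS]/Num.norm/= mx_normrE.
exact: (le_bigmax _ (fun i : 'I_1 * 'I_n => `|x i.1 i.2|) (0, j)).
Qed.

(** The crude factor n instead of its square root suffices for passing from the max-norm topology to
    Euclidean estimates. *)
Lemma enorm_le_norm x : enorm x <= n%:R * `|x|.
Proof.
rewrite -(ler_pXn2r (n := 2)) ?nnegrE ?mulr_ge0 ?enorm_ge0//.
rewrite sqr_enorm exprMn.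
apply: (@le_trans _ _ (n%:R * `|x| ^+ 2)).
  rewrite -[X in X%:R * _]card_ord -sumr_const mulr_suml.
  apply: ler_sum => j _; rewrite mul1r -expr2 -real_normK ?num_real//.
  by rewrite ler_pXn2r ?nnegrE// coord_le_norm.
rewrite ler_wpM2r ?sqr_ge0// -natrX ler_nat.
by case: (n) => // m; rewrite leq_pmulr.
Qed.

Lemma enorm_lt x (e : R) : 0 < e -> `|x| < e / (n%:R + 1) -> enorm x < e.
Proof.
have n0 : 0 < n%:R + 1 :> R by rewrite ltr_wpDl.
move=> e0; rewrite ltr_pdivlMr// mulrC; apply: le_lt_trans.
by rewrite (le_trans (enorm_le_norm _))// ler_wpM2r// lerDl.
Qed.

Lemma derive_grad f x y : differentiable f x -> 'D_y f x = dotv (grad f x) y.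
Proof.
move=> df; rewrite deriveE// [in LHS](row_sum_delta y) linear_sum/=.
by apply: eq_bigr => j _; rewrite linearZ/= mxE deriveE// mulrC.
Qed.

Lemma is_derive_line f x y (s : R) : differentiable f (x + s *: y) ->
  is_derive s 1 (fun r : R => f (x + r *: y)) (dotv (grad f (x + s *: y)) y).
Proof.
move=> df.
have E : (fun h : R => h^-1 *: (f (x + (h *: 1 + s) *: y) - f (x + s *: y))) =
         (fun h : R => h^-1 *: (f (h *: y + (x + s *: y)) - f (x + s *: y))).
  apply/funext => h; congr (_ *: (f _ - _)).
  by rewrite -[h *: 1]/(h * 1) mulr1 scalerDl addrCA.
split; first by rewrite /derivable /= E; exact: diff_derivable.
by rewrite -derive_grad// /derive /= E.
Qed.

(** The mean value theorem on the segment, comparing the gradient at one intermediate point with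
    that at [x]. This gives the constant L where integration would give L / 2; only the order
    matters later. *)
Lemma descent f (L : R) x y : (forall z, differentiable f z) -> 0 <= L ->
  grad_lipschitz L f ->
  f y <= f x + dotv (grad f x) (y - x) + L * enorm (y - x) ^+ 2.
Proof.
move=> df L0 lip.
pose h (r : R) := f (x + r *: (y - x)).
have dh (s : R) : is_derive s 1 h (dotv (grad f (x + s *: (y - x))) (y - x)).
  exact: is_derive_line.
have [|c /[!in_itv]/= /andP[c0 c1]] := @MVT R h _ 0 1 ltr01 (fun s _ => dh s).
  apply/continuous_subspaceT => s.
  by apply/differentiable_continuous/derivable1_diffP; case: (dh s).
rewrite /h scale1r scale0r addr0 !subr0 mulr1 [x + (y - x)]addrC subrK => H.
rewrite -lerBlDl opprD addrA in H *.
have -> : f y - f x - dotv (grad f x) (y - x) =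
    dotv (grad f (x + c *: (y - x)) - grad f x) (y - x).
  by rewrite H dotvDl dotvNl.
apply: le_trans (dotv_le _ _) _.
rewrite expr2 mulrA ler_wpM2r ?enorm_ge0// (le_trans (lip _ _))// ler_wpM2l//.
by rewrite addrAC subrr add0r enormZ gtr0_norm// ler_piMl ?enorm_ge0// ltW.
Qed.

Lemma grad_lipschitz_continuous f (L : R) : 0 <= L -> grad_lipschitz L f ->
  continuous (grad f).
Proof.
move=> L0 lip x; apply/(@cvgrPdist_lt _ _ _ (nbhs x)) => e e0.
have K0 : 0 < L * n%:R + 1 by rewrite ltr_wpDl// mulr_ge0.
near=> y.
apply: le_lt_trans (norm_le_enorm _) _; apply: le_lt_trans (lip _ _) _.
apply: (@le_lt_trans _ _ ((L * n%:R + 1) * `|x - y|)).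
  apply: (@le_trans _ _ (L * n%:R * `|x - y|)).
    by rewrite -mulrA ler_wpM2l// enorm_le_norm.
  by rewrite ler_wpM2r// lerDl.
rewrite mulrC -ltr_pdivlMr//; near: y.
by apply: cvgr_dist_lt => //; rewrite divr_gt0.
Unshelve. all: by end_near. Qed.

End EuclideanNorm.

(** * Gradient of the averaged objective *)

Section Average.
Context {R : realType} {n N : nat}.
Variable fi : 'I_N -> 'rV[R]_n -> R.
Hypothesis dfi : forall i x, differentiable (fi i) x.

Lemma averageE : average fi = N%:R^-1 *: \sum_(i < N) fi i.
Proof. by apply/funext => x; rewrite /average /GRing.scale/= fct_sumE. Qed.

Lemma differentiable_average x : differentiable (average fi) x.
Proof.
by rewrite averageE; apply/differentiableZ/differentiable_sum => i; exact: dfi.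
Qed.

Lemma grad_average x :
  grad (average fi) x = N%:R^-1 *: \sum_(i < N) grad (fi i) x.
Proof.
have D (j : 'I_n) i : derivable (fi i) x (delta_mx 0 j).
  exact/diff_derivable/dfi.
apply/rowP => j; rewrite !mxE averageE deriveZ; last exact: derivable_sum.
rewrite derive_sum// summxE; congr (_ * _).
by apply: eq_bigr => i _; rewrite mxE.
Qed.

Lemma sum_grad x : (0 < N)%N ->
  \sum_(i < N) grad (fi i) x = N%:R *: grad (average fi) x.
Proof.
by move=> N0; rewrite grad_average scalerA mulfV ?scale1r// pnatr_eq0 -lt0n.
Qed.

Lemma grad_lipschitz_average (L : R) : (0 < N)%N ->
  (forall i, grad_lipschitz L (fi i)) -> grad_lipschitz L (average fi).
Proof.
move=> N0 lip x y; rewrite !grad_average -scalerBr -sumrB enormZ.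
rewrite ger0_norm ?invr_ge0// ler_pdivrMl ?ltr0n//.
apply: le_trans (enorm_sum _ _) _.
apply: le_trans (ler_sum _ (fun i _ => lip i x y)) _.
by rewrite sumr_const card_ord mulr_natl.
Qed.

End Average.

(** * One epoch as a perturbed gradient step *)

Section Epoch.
Context {R : realType} {n N : nat}.
Variables (fi : 'I_N -> 'rV[R]_n -> R) (L : R).
Hypotheses (N_gt0 : (0 < N)%N) (L_gt0 : 0 < L).
Hypothesis dfi : forall i x, differentiable (fi i) x.
Hypothesis lipfi : forall i, grad_lipschitz L (fi i).
Let f := average fi.

Lemma grad_bounded (M : R) : exists2 G : R, 0 <= G &
  forall i x, enorm x <= M -> enorm (grad (fi i) x) <= G.
Proof.
have S0 : 0 <= \sum_(i < N) enorm (grad (fi i) 0).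
  by apply: sumr_ge0 => i _; exact: enorm_ge0.
exists (\sum_(i < N) enorm (grad (fi i) 0) + L * `|M|).
  by rewrite addr_ge0// mulr_ge0// ltW.
move=> i x xM; have := enorm_sub_ge (grad (fi i) x) (grad (fi i) 0).
have := lipfi i x 0; rewrite subr0.
have : L * enorm x <= L * `|M|.
  by rewrite ler_wpM2l ?(ltW L_gt0)// (le_trans xM)// ler_norm.
have : enorm (grad (fi i) 0) <= \sum_(i < N) enorm (grad (fi i) 0).
  rewrite [leRHS](bigD1 i)//= lerDl.
  by apply: sumr_ge0 => j _; exact: enorm_ge0.
set g0 := enorm (grad _ 0); set S := bigop _ _ _; set gx := enorm (grad _ x).
move=> *; lra.
Qed.

(** Induction on the number of inner steps. The drift so far is O(a), so by Lipschitz continuity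
    evaluating the next gradient at the drifted point costs O(a), and O(a^2) after multiplication by
    a. [B] and [D] are fixed before the permutation, hence uniform in it. *)
Lemma incremental_steps_error (M alpha : R) (l : seq 'I_N) : 0 <= alpha ->
  exists B D : R, [/\ 0 <= B, 0 <= D & forall (a : R) (s : 'S_N) x,
    0 <= a <= alpha -> enorm x <= M ->
    let y := foldl (fun y i => y - a *: grad (fi (s i)) y) x l in
    enorm (y - x) <= a * B /\
    enorm (y - x + a *: \sum_(i <- l) grad (fi (s i)) x) <= a ^+ 2 * D].
Proof.
move=> al0; have [G G0 HG] := grad_bounded M.
elim/last_ind: l => [|l i [B [D [B0 D0 H]]]].
  exists 0, 0; split=> // a s x _ _ /=.
  by rewrite subrr big_nil scaler0 addr0 enorm0 !mulr0.
exists (B + (G + L * (alpha * B))), (D + L * B); split=> [||a s x aal xM].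
- by rewrite !addr_ge0 ?mulr_ge0// ltW.
- by rewrite addr_ge0 ?mulr_ge0// ltW.
have /andP[a0 aa] := aal.
have [] := H a s x aal xM; rewrite -cats1 foldl_cat big_cat big_seq1/=.
set y := foldl _ _ _; set S := \sum_(i <- l) _; set g := grad (fi (s i)).
move=> yx yS.
have gy : enorm (g y - g x) <= L * (a * B).
  by apply: le_trans (lipfi _ _ _) _; rewrite ler_wpM2l// ltW.
split.
  rewrite addrAC; apply: le_trans (enormD _ _) _.
  rewrite enormN enormZ ger0_norm// mulrDr lerD// ler_wpM2l//.
  rewrite -(subrK (g x) (g y)) (le_trans (enormD _ _))// addrC lerD ?HG//.
  by rewrite (le_trans gy)// ler_wpM2l ?(ltW L_gt0)// ler_wpM2r.
have -> : y - a *: g y - x + a *: (S + g x) =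
    (y - x + a *: S) + (- a) *: (g y - g x).
  rewrite !scalerDr scalerN !scaleNr opprK -!addrA; congr (_ + _).
  by rewrite addrCA; congr (_ + _); rewrite addrCA.
apply: le_trans (enormD _ _) _; rewrite mulrDr lerD//.
rewrite enormZ normrN ger0_norm// expr2 -mulrA ler_wpM2l//.
by rewrite (le_trans gy)// mulrCA.
Qed.

(** A full epoch visits every index once, so reindexing by the permutation turns the sum of
    component gradients into N grad f. *)
Lemma epoch_error (M alpha : R) : 0 <= alpha ->
  exists2 D : R, 0 <= D & forall (a : R) (s : 'S_N) x,
    0 <= a <= alpha -> enorm x <= M ->
    enorm (epoch fi a s x - x + (a * N%:R) *: grad f x) <= D * a ^+ 2.
Proof.
move=> al0.
have [B [D [_ D0 H]]] := incremental_steps_error M (enum 'I_N) al0.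
exists D => // a s x aal xM; have [_] := H a s x aal xM.
rewrite -/(epoch fi a s x) mulrC; congr (enorm (_ + _) <= _).
rewrite -scalerA -sum_grad//; congr (_ *: _).
by rewrite big_enum/= [RHS](reindex_inj (@perm_inj _ s)).
Qed.

(** The gradient step gains N a g^2 in first order. One quarter absorbs the cross term g D a^2 by
    completing a square, another the main part of L |x' - x|^2 thanks to 8 L N a <= 1; one half
    remains. *)
Lemma epoch_descent (M alpha : R) : 0 < alpha ->
  exists C D : R, [/\ 0 < C, 0 < D & forall (a : R) (s : 'S_N) x,
    0 <= a <= alpha -> enorm x <= M ->
    enorm (epoch fi a s x - x) <= N%:R * (a * enorm (grad f x)) + D * a ^+ 2 /\
    (8 * L * N%:R * a <= 1 ->
     f (epoch fi a s x) <=
       f x - N%:R / 2 * a * enorm (grad f x) ^+ 2 + C * a ^+ 3)].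
Proof.
move=> al0.
have [D0 D00 H] := epoch_error M (ltW al0).
have N0 : 0 < N%:R :> R by rewrite ltr0n.
pose D := D0 + 1; have D1 : 0 < D by rewrite ltr_wpDl.
exists (D ^+ 2 / N%:R + 2 * L * D ^+ 2 * alpha), D; split=> //.
  by rewrite addr_gt0 ?divr_gt0 ?mulr_gt0 ?exprn_gt0.
move=> a s x aal xM; have /andP[a0 aa] := aal.
set x' := epoch _ _ _ _; set r := x' - x + (a * N%:R) *: grad f x.
have rD : enorm r <= D * a ^+ 2.
  by rewrite (le_trans (H _ _ _ aal xM))// ler_wpM2r ?sqr_ge0// lerDl.
have xE : x' - x = - (a * N%:R) *: grad f x + r.
  by rewrite scaleNr /r addrCA addNr addr0.
set g := enorm (grad f x); have g0 : 0 <= g by exact: enorm_ge0.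
have step : enorm (x' - x) <= N%:R * (a * g) + D * a ^+ 2.
  rewrite xE; apply: le_trans (enormD _ _) _; rewrite lerD//.
  by rewrite enormZ normrN ger0_norm ?mulr_ge0// mulrCA mulrA.
split=> // small.
have df x0 : differentiable f x0 by exact: differentiable_average.
have lipf := grad_lipschitz_average dfi N_gt0 lipfi.
apply: le_trans (descent x x' df (ltW L_gt0) lipf) _.
have E : dotv (grad f x) (x' - x) <= - (a * N%:R) * g ^+ 2 + g * (D * a ^+ 2).
  rewrite xE dotvDr dotvZr -sqr_enorm lerD2l.
  by rewrite (le_trans (dotv_le _ _))// ler_wpM2l.
have E2 : enorm (x' - x) ^+ 2 <=
    2 * (N%:R * (a * g)) ^+ 2 + 2 * (D * a ^+ 2) ^+ 2.
  apply: (@le_trans _ _ ((N%:R * (a * g) + D * a ^+ 2) ^+ 2)).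
    by rewrite ler_pXn2r ?nnegrE ?enorm_ge0// (le_trans (enorm_ge0 _) step).
  by have := sqr_ge0 (N%:R * (a * g) - D * a ^+ 2); nra.
have {}E2 := ler_wpM2l (ltW L_gt0) E2.
have E3 : g * (D * a ^+ 2) <= N%:R / 4 * a * g ^+ 2 + D ^+ 2 / N%:R * a ^+ 3.
  rewrite -subr_ge0.
  have -> : N%:R / 4 * a * g ^+ 2 + D ^+ 2 / N%:R * a ^+ 3 - g * (D * a ^+ 2) =
      a / N%:R * (N%:R / 2 * g - D * a) ^+ 2 by field; rewrite gt_eqF.
  by rewrite mulr_ge0 ?sqr_ge0// divr_ge0// ltW.
have E4 : L * (2 * (N%:R * (a * g)) ^+ 2) <= N%:R / 4 * a * g ^+ 2.
  have -> : L * (2 * (N%:R * (a * g)) ^+ 2) =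
    (8 * L * N%:R * a) * (N%:R / 4 * a * g ^+ 2) by field.
  by rewrite ler_piMl// !mulr_ge0 ?sqr_ge0 ?invr_ge0// ltW.
have E5 : L * (2 * (D * a ^+ 2) ^+ 2) <= 2 * L * D ^+ 2 * alpha * a ^+ 3.
  have -> : L * (2 * (D * a ^+ 2) ^+ 2) = 2 * L * D ^+ 2 * a * a ^+ 3 by ring.
  by rewrite ler_wpM2r ?exprn_ge0// ler_wpM2l// !mulr_ge0 ?sqr_ge0// ltW.
rewrite mulrDl; move: E E2 E3 E4 E5; rewrite mulrDr.
set d := dotv _ _; set e := enorm _ ^+ 2.
set u := _ * a ^+ 3; set v := _ * a ^+ 3.
lra.
Qed.

End Epoch.

(** * Trapping a sequence whose steps are bounded by the decrease of a potential *)

Section Trap.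
Context {R : realType} {n : nat}.
Variables (x : nat -> 'rV[R]_n) (xbar : 'rV[R]_n).
Variables (Lam : R^nat) (r : R) (T : nat).
Hypothesis Lam_ge0 : forall t, (T <= t)%N -> 0 <= Lam t.
Hypothesis trap : forall t, (T <= t)%N -> enorm (x t - xbar) < r ->
  enorm (x t.+1 - x t) <= Lam t - Lam t.+1.

(** The step bounds telescope, so the sequence has moved by at most [Lam t], is still in the ball,
    and the step hypothesis applies once more. *)
Lemma trapped t k : (T <= t)%N -> enorm (x t - xbar) + Lam t < r ->
  enorm (x (k + t)%N - x t) <= Lam t - Lam (k + t)%N.
Proof.
move=> Tt xr; elim: k => [|k IH]; first by rewrite add0n !subrr enorm0.
have Tk : (T <= k + t)%N by rewrite (leq_trans Tt)// leq_addl.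
have near : enorm (x (k + t)%N - xbar) < r.
  have := enormD (x (k + t)%N - x t) (x t - xbar); rewrite addrA subrK.
  have := Lam_ge0 Tk; lra.
have := enormD (x (k + t).+1 - x (k + t)%N) (x (k + t)%N - x t).
rewrite addrA subrK; have := trap Tk near; rewrite addSn; lra.
Qed.

Lemma trapped_dist t s : (T <= t)%N -> (t <= s)%N ->
  enorm (x t - xbar) + Lam t < r ->
  enorm (x s - xbar) <= enorm (x t - xbar) + Lam t.
Proof.
move=> Tt ts H; have := trapped (s - t) Tt H; rewrite subnK//.
have := enormD (x s - x t) (x t - xbar); rewrite addrA subrK.
have := Lam_ge0 (leq_trans Tt ts); lra.
Qed.

(** At a late visit near [xbar], distance and potential are each below half of min(e, r); from then
    on the sequence cannot leave the e-ball. *)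
Lemma trapped_cvg : 0 < r ->
  (forall e, 0 < e -> exists S, forall t, (S <= t)%N -> Lam t < e) ->
  (forall e S, 0 < e -> exists2 t, (S <= t)%N & enorm (x t - xbar) < e) ->
  forall e, 0 < e -> exists S, forall t, (S <= t)%N -> enorm (x t - xbar) < e.
Proof.
move=> r0 Lam0 clu e e0.
have d0 : 0 < Num.min e r / 2 by rewrite divr_gt0// lt_min e0.
have [S HS] := Lam0 _ d0.
have [t] := clu _ (maxn S T) d0; rewrite geq_max => /andP[St Tt] xt.
have H : enorm (x t - xbar) + Lam t < Num.min e r.
  by rewrite [ltRHS]splitr ltrD// HS.
move: H; rewrite lt_min => /andP[He Hr].
by exists t => s ts; rewrite (le_lt_trans (trapped_dist Tt ts Hr)).
Qed.

(** Let k tend to infinity in [trapped]: the distance to the limit is at most the remaining path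
    length. *)
Lemma trapped_rate : 0 < r ->
  (forall e, 0 < e -> exists S, forall t, (S <= t)%N -> Lam t < e) ->
  (forall e, 0 < e ->
     exists S, forall t, (S <= t)%N -> enorm (x t - xbar) < e) ->
  exists S, forall t, (S <= t)%N -> enorm (x t - xbar) <= Lam t.
Proof.
move=> r0 Lam0 xc; have r20 : 0 < r / 2 by rewrite divr_gt0.
have [S1 H1] := Lam0 _ r20; have [S2 H2] := xc _ r20.
exists (maxn T (maxn S1 S2)) => t; rewrite !geq_max => /and3P[Tt St1 St2].
have H : enorm (x t - xbar) + Lam t < r by rewrite [ltRHS]splitr ltrD ?H1 ?H2.
apply/ler_addgt0Pr => e e0; have [S3 H3] := xc _ e0.
have := trapped S3 Tt H.
have := H3 _ (leq_addr t S3).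
have := enormD (x t - x (S3 + t)%N) (x (S3 + t)%N - xbar).
have Tk : (T <= S3 + t)%N by rewrite (leq_trans Tt)// leq_addl.
have := Lam_ge0 Tk; rewrite addrA subrK (enormBC (x t)); lra.
Qed.

End Trap.

(** * The KL inequality in power form *)

Section KL.
Context {R : realType} {n : nat}.
Variables (f : 'rV[R]_n -> R) (xbar : 'rV[R]_n).

Lemma enorm_ball_nbhs (U : set 'rV[R]_n) : nbhs xbar U ->
  exists2 r : R, 0 < r & forall z, enorm (z - xbar) < r -> U z.
Proof.
move=> /nbhs_normP[r /= r0 H]; exists r => // z zr.
by apply: H => /=; rewrite distrC (le_lt_trans (norm_le_enorm _)).
Qed.

(** Where |f - f(xbar)| < 1, a larger exponent only lowers the left-hand side. At points with f z =
    f xbar the KL inequality is silent, and [0 < theta] makes the power vanish there. *)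
Lemma KL_raise_exponent (theta0 theta c : R) : {for xbar, continuous f} ->
  KL_exponent_constant f xbar theta0 c -> theta0 <= theta < 1 -> 0 < theta ->
  exists2 r : R, 0 < r & forall z, enorm (z - xbar) < r ->
    `|f z - f xbar| `^ theta <= c * enorm (grad f z).
Proof.
move=> cf [c0 /andP[th00 th01] [eta [eta0 [U nU HU]]]] /andP[th0 th1] thpos.
(* A real radius below both 1 and the possibly infinite [eta]. *)
have [d [d0 d1 deta]] : exists d : R, [/\ 0 < d, d <= 1 & (d%:E <= eta)%E].
  case: eta eta0 {HU} => [e| |]//; last by exists 1; rewrite ltr01 lexx leey.
  rewrite lte_fin => e0; exists (Num.min 1 e); rewrite lt_min ltr01 e0.
  by rewrite ge_min lexx lee_fin ge_min lexx orbT.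
have nV : nbhs xbar (U `&` [set z | `|f z - f xbar| < d]).
  apply: filterI => //; have /cvgrPdist_lt/(_ _ d0) := cf.
  by apply: filterS => z /=; rewrite distrC.
have [r r0 Hr] := enorm_ball_nbhs nV.
exists r => // z /Hr[Uz /= zd].
have [v0|v0] := eqVneq `|f z - f xbar| 0.
  by rewrite v0 powR0 ?gt_eqF// mulr_ge0 ?enorm_ge0 ?ltW.
have {}v0 : 0 < `|f z - f xbar| by rewrite lt_def v0 normr_ge0.
set v : R := `|f z - f xbar| in v0 zd *.
have := HU z Uz v0 (lt_le_trans _ deta); rewrite -/v lte_fin => /(_ zd).
have -> : derive1 (lojasiewicz c theta0) v =
    c * ((1 - theta0) * v `^ (- theta0)).
  rewrite derive1E; have := is_derive1_powR (1 - theta0) v0 => D.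
  have -> : lojasiewicz c theta0 = c *: (@powR R ^~ (1 - theta0)) by [].
  rewrite deriveZ//= derive_val; congr (_ * (_ * _ `^ _)); ring.
move=> H.
apply: (@le_trans _ _ (v `^ theta0)).
  by rewrite ger_powR// v0 (le_trans (ltW zd)).
have vth : 0 < v `^ theta0 by rewrite powR_gt0.
move: H; rewrite powRN => /(ler_wpM2l (ltW vth)).
rewrite mulr1 => /le_trans; apply.
have -> : v `^ theta0 * (c * ((1 - theta0) / v `^ theta0) * enorm (grad f z)) =
    (1 - theta0) * (c * enorm (grad f z)) by field; rewrite gt_eqF.
by rewrite ler_piMl ?mulr_ge0 ?enorm_ge0 ?(ltW c0)// gerBl.
Qed.

End KL.

(** * Convergence and rate for a trajectory with perturbed descent *)

Section Trajectory.
Context {R : realType} {n : nat}.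
Variables (x : nat -> 'rV[R]_n) (f : 'rV[R]_n -> R) (xbar : 'rV[R]_n).
Variables (alpha gamma t0 m nu C D : R) (T1 : nat).
Hypotheses (alpha_gt0 : 0 < alpha) (gamma_bounds : 2^-1 < gamma <= 1).
Hypotheses (t0_ge1 : 1 <= t0) (m_gt0 : 0 < m) (nu_gt0 : 0 < nu).
Hypotheses (C_gt0 : 0 < C) (D_gt0 : 0 < D).

(** In the application [t0] is 1 + beta, [m] is N / 2 and [nu] is N; [a t] is the step leading from
    [x t] to [x t.+1]. *)
Let tau (t : nat) : R := t%:R + t0.
Let a (t : nat) : R := alpha * tau t `^ (- gamma).
Let g (t : nat) : R := enorm (grad f (x t)).

Hypothesis step_le : forall t,
  enorm (x t.+1 - x t) <= nu * (a t * g t) + D * a t ^+ 2.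
Hypothesis descent_le : forall t, (T1 <= t)%N ->
  f (x t.+1) <= f (x t) - m * a t * g t ^+ 2 + C * a t ^+ 3.
Hypothesis cluster : forall e S, 0 < e ->
  exists2 t, (S <= t)%N & enorm (x t - xbar) < e.
Hypothesis cont_f : {for xbar, continuous f}.

(* [u] dominates the tail sums of [C a_k^3], which makes [y] nonincreasing. *)
Let rho : R := 3 * gamma - 1.
Let Cu : R := C * alpha ^+ 3 / (rho * 2 `^ (- (rho + 1))).
Let u (t : nat) : R := Cu * tau t `^ (- rho).
Let y (t : nat) : R := f (x t) - f xbar + u t.

Let gamma_gt : 2^-1 < gamma. Proof. by case/andP: gamma_bounds. Qed.
Let gamma_le : gamma <= 1. Proof. by case/andP: gamma_bounds. Qed.
Let rho_gt0 : 0 < rho. Proof. by move: gamma_gt; rewrite /rho; lra. Qed.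
Let tau_ge1 t : 1 <= tau t. Proof. by rewrite (le_trans t0_ge1)// lerDr. Qed.
Let tau_gt0 t : 0 < tau t. Proof. exact: lt_le_trans (tau_ge1 t). Qed.
Let tauS t : tau t.+1 = tau t + 1. Proof. by rewrite /tau -natr1 addrAC. Qed.
Let a_gt0 t : 0 < a t. Proof. by rewrite mulr_gt0// powR_gt0. Qed.
Let g_ge0 t : 0 <= g t. Proof. exact: enorm_ge0. Qed.
Let Cu_gt0 : 0 < Cu.
Proof. by rewrite divr_gt0 ?mulr_gt0 ?exprn_gt0 ?powR_gt0. Qed.
Let u_gt0 t : 0 < u t. Proof. by rewrite mulr_gt0 ?powR_gt0. Qed.

Let powR_tauN_cvg0 (s : R) : 0 < s -> forall e, 0 < e ->
  exists S, forall t, (S <= t)%N -> tau t `^ (- s) < e.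
Proof. exact/powRN_shift_cvg0/(le_trans ler01 t0_ge1). Qed.

(** Used with s = rho for the a^3 errors in the descent and with s = 2 gamma - 1 for the a^2 errors
    in the path length; this explains the denominators in [Cu] and [K2]. *)
Let tauN_telescope (s : R) t : 0 < s ->
  tau t `^ (- (s + 1)) <=
  (s * 2 `^ (- (s + 1)))^-1 * (tau t `^ (- s) - tau t.+1 `^ (- s)).
Proof.
move=> s0; rewrite ler_pdivlMl ?mulr_gt0 ?powR_gt0// tauS.
by rewrite powRN_succ_diff_ge// ltW.
Qed.

Let a2E t : a t ^+ 2 = alpha ^+ 2 * tau t `^ (- (2 * gamma - 1 + 1)).
Proof.
rewrite exprMn -[X in _ * X]powR_mulrn ?powR_ge0// -powRrM.
by congr (_ * _ `^ _); ring.
Qed.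

Let a3E t : a t ^+ 3 = alpha ^+ 3 * tau t `^ (- (rho + 1)).
Proof.
rewrite exprMn -[X in _ * X]powR_mulrn ?powR_ge0// -powRrM.
by congr (_ * _ `^ _); rewrite /rho; ring.
Qed.

Let u_telescope t : C * a t ^+ 3 <= u t - u t.+1.
Proof.
rewrite a3E mulrA -mulrBr.
have CA : 0 <= C * alpha ^+ 3 by rewrite mulr_ge0 ?exprn_ge0 ?ltW.
apply: le_trans (ler_wpM2l CA (tauN_telescope t rho_gt0)) _.
by rewrite mulrA.
Qed.

Let y_descent t : (T1 <= t)%N -> y t.+1 <= y t - m * a t * g t ^+ 2.
Proof.
move=> Tt; have := descent_le Tt; have := u_telescope t; rewrite /y.
set w := m * _ * _; lra.
Qed.

Let y_nonincr t k : (T1 <= t)%N -> y (k + t)%N <= y t.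
Proof.
move=> Tt; elim: k => [//|k IH]; rewrite addSn.
have Tk : (T1 <= k + t)%N by rewrite (leq_trans Tt)// leq_addl.
apply: le_trans (y_descent Tk) (le_trans _ IH).
by rewrite gerBl (mulr_ge0 (mulr_ge0 (ltW m_gt0) (ltW (a_gt0 _))))// sqr_ge0.
Qed.

Let f_cluster e S : 0 < e ->
  exists2 t, (S <= t)%N & `|f (x t) - f xbar| < e.
Proof.
move=> e0; have nV : nbhs xbar [set z | `|f z - f xbar| < e].
  have /cvgrPdist_lt/(_ _ e0) := cont_f.
  by apply: filterS => z /=; rewrite distrC.
have [r r0 Hr] := enorm_ball_nbhs nV.
by have [t St /Hr] := cluster S r0; exists t.
Qed.

(** By monotonicity [y t] is at least its value at late visits near [xbar], where f is almost
    f(xbar) and u is positive. *)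
Let y_ge0 t : (T1 <= t)%N -> 0 <= y t.
Proof.
move=> Tt; apply/ler_addgt0Pr => e e0.
have [s ts] := f_cluster t e0; rewrite ltr_norml => /andP[se _].
have := y_nonincr (s - t) Tt; rewrite subnK//.
have := u_gt0 s; rewrite {1}/y; lra.
Qed.

Let y_cvg0 e : 0 < e -> exists S, forall t, (S <= t)%N -> y t < e.
Proof.
move=> e0; have e20 : 0 < e / 2 by rewrite divr_gt0.
have [S HS] := powR_tauN_cvg0 rho_gt0 (divr_gt0 e20 Cu_gt0).
have [s] := f_cluster (maxn S T1) e20.
rewrite geq_max => /andP[Ss Ts]; rewrite ltr_norml => /andP[_ se].
have us : u s < e / 2 by rewrite /u mulrC -ltr_pdivlMr// HS.
exists s => t st; have := y_nonincr (t - s) Ts; rewrite subnK// => /le_lt_trans.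
by apply; rewrite /y; lra.
Qed.

Section Exponent.
Variables (theta c : R).
Hypotheses (theta_lt1 : theta < 1) (theta_ge : gamma <= theta * rho).
Hypothesis c_gt0 : 0 < c.

Let theta_gt0 : 0 < theta.
Proof.
rewrite -(pmulr_lgt0 _ rho_gt0) (lt_le_trans _ theta_ge)//.
by move: gamma_gt; lra.
Qed.

(** [K1] is the constant of [powR_step_le] times [nu]. [K2] collects the two errors of order tau^(-2
    gamma), namely nu a u^theta and D a^2, times the telescoping constant. *)
Let K1 : R := nu * ((c + 1) / (m * (1 - theta))).
Let K2 : R := (nu * (alpha * Cu `^ theta) + D * alpha ^+ 2) *
  ((2 * gamma - 1) * 2 `^ (- (2 * gamma - 1 + 1)))^-1.

(* An upper bound on the length of the remaining path. *)
Definition residual_length (t : nat) : R :=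
  K1 * y t `^ (1 - theta) + K2 * tau t `^ (- (2 * gamma - 1)).

Let K1_ge0 : 0 <= K1.
Proof.
rewrite mulr_ge0 ?(ltW nu_gt0)// divr_ge0 ?mulr_ge0 ?(ltW m_gt0) ?subr_ge0//.
- by rewrite addr_ge0// ltW.
- exact: ltW.
Qed.

Let K2_gt0 : 0 < K2.
Proof.
have H : 0 < 2 * gamma - 1 by move: gamma_gt; lra.
rewrite divr_gt0 ?mulr_gt0 ?powR_gt0//.
by rewrite addr_gt0 ?mulr_gt0 ?exprn_gt0 ?powR_gt0.
Qed.

Lemma residual_length_ge0 t : 0 <= residual_length t.
Proof.
exact: addr_ge0 (mulr_ge0 K1_ge0 (powR_ge0 _ _))
  (mulr_ge0 (ltW K2_gt0) (powR_ge0 _ _)).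
Qed.

Lemma residual_length_cvg0 e : 0 < e ->
  exists S, forall t, (S <= t)%N -> residual_length t < e.
Proof.
move=> e0; have e20 : 0 < e / 2 by rewrite divr_gt0.
have th1 : 0 < 1 - theta by rewrite subr_gt0.
have K1' : 0 < K1 + 1 by rewrite ltr_wpDl.
have e2K : 0 < e / 2 / (K1 + 1) by rewrite divr_gt0.
have H : 0 < 2 * gamma - 1 by move: gamma_gt; lra.
have [S HS] := powR_tauN_cvg0 H (divr_gt0 e20 K2_gt0).
have [S' HS'] := y_cvg0 (powR_gt0 (1 - theta)^-1 e2K).
exists (maxn T1 (maxn S S')) => t; rewrite !geq_max => /and3P[Tt St St'].
rewrite [ltRHS]splitr; apply: ler_ltD; last first.
  by rewrite mulrC -ltr_pdivlMr// HS.
apply: (@le_trans _ _ ((K1 + 1) * (e / 2 / (K1 + 1)))); last first.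
  by rewrite mulrC divfK// gt_eqF.
apply: ler_pM; rewrite ?powR_ge0 ?lerDl//.
have -> : e / 2 / (K1 + 1) =
    ((e / 2 / (K1 + 1)) `^ (1 - theta)^-1) `^ (1 - theta).
  by rewrite -powRrM mulVf ?powRr1 ?(ltW e2K)// gt_eqF.
by rewrite ge0_ler_powR ?nnegrE ?powR_ge0 ?y_ge0 ?(ltW th1)// ltW// HS'.
Qed.

Section KLBound.
Variable t : nat.
Hypotheses (T1t : (T1 <= t)%N).
Hypothesis KLt : `|f (x t) - f xbar| `^ theta <= c * g t.

(** Subadditivity of the power carries the KL bound from f to [y] at the price of u^theta. *)
Let y_KL : y t `^ theta <= c * g t + u t `^ theta.
Proof.
have th : 0 < theta <= 1 by rewrite theta_gt0 ltW.
apply: (@le_trans _ _ ((`|f (x t) - f xbar| + u t) `^ theta)).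
  rewrite ge0_ler_powR ?nnegrE ?y_ge0 ?addr_ge0//.
  - exact: ltW.
  - exact: ltW.
  by rewrite lerD2r ler_norm.
apply: le_trans (powR_subadditive _ _ th) _ => //; first exact: ltW.
by rewrite lerD2r.
Qed.

Let uE s : u t `^ s = Cu `^ s * tau t `^ (- (rho * s)).
Proof.
by rewrite /u powRM ?powR_ge0 ?(ltW Cu_gt0)// -powRrM mulNr.
Qed.

(** [powR_step_le] bounds a g by the decrease of y^(1 - theta) plus a u^theta; this remainder and D
    a^2 telescope into the second term of [residual_length]. *)
Lemma step_le_residual_length :
  enorm (x t.+1 - x t) <= residual_length t - residual_length t.+1.
Proof.
have T1t' : (T1 <= t.+1)%N by rewrite leqW.
have th : 0 < theta < 1 by rewrite theta_gt0.
have := powR_step_le (y_ge0 T1t') (y_ge0 T1t) th (ltW (a_gt0 t)) m_gt0 c_gt0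
  (g_ge0 t) (powR_ge0 (u t) theta) (y_descent T1t) y_KL.
set dy := _ `^ _ - _ `^ _ => H.
(* Here [theta_ge] enters: gamma + rho theta >= 2 gamma, so this noise is no larger in order than
   a^2. *)
have au : a t * u t `^ theta <=
    alpha * Cu `^ theta * tau t `^ (- (2 * gamma - 1 + 1)).
  have -> : a t * u t `^ theta =
      alpha * Cu `^ theta * tau t `^ (- (gamma + rho * theta)).
    rewrite uE opprD powRD ?(gt_eqF (tau_gt0 t)) ?implybT// /a; ring.
  rewrite ler_wpM2l ?mulr_ge0 ?powR_ge0 ?(ltW alpha_gt0)//.
  by rewrite ler_powR// lerN2; move: theta_ge; rewrite mulrC; lra.
have H2 : 0 < 2 * gamma - 1 by move: gamma_gt; lra.
have K20 : 0 <= nu * (alpha * Cu `^ theta) + D * alpha ^+ 2.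
  by rewrite addr_ge0 ?mulr_ge0 ?exprn_ge0 ?powR_ge0 ?ltW.
have HK : (nu * (alpha * Cu `^ theta) + D * alpha ^+ 2) *
    tau t `^ (- (2 * gamma - 1 + 1)) <=
    K2 * (tau t `^ (- (2 * gamma - 1)) - tau t.+1 `^ (- (2 * gamma - 1))).
  by rewrite /K2 -[leRHS]mulrA; exact: (ler_wpM2l K20 (tauN_telescope t H2)).
move: HK.
have nu0 := ltW nu_gt0.
have {H} := ler_wpM2l nu0 H; rewrite mulrDr.
have {au} := ler_wpM2l nu0 au.
have := step_le t; rewrite a2E /residual_length.
have -> : nu * ((c + 1) / (m * (1 - theta)) * dy) = K1 * dy by exact: mulrA.
rewrite /dy; set Y := y t `^ _; set Y' := y t.+1 `^ _.
set Z := tau t `^ (- (_ - 1)); set Z' := tau t.+1 `^ _.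
set W := tau t `^ _; set dx := enorm _.
set ag := nu * (a t * g t); set au := nu * (a t * _); set E := Cu `^ _.
have -> : nu * (alpha * E * W) = nu * (alpha * E) * W by ring.
rewrite (mulrA D) !mulrBr mulrDl.
by move: K1 K2 => k1 k2; set p := _ * W; set q := _ * W; lra.
Qed.

(** Squaring [y_KL] bounds g^2 below by y^(2 theta) up to u^(2 theta), which is inserted in the
    descent. The noise has exponent gamma + 2 theta rho, at least 1 + p because p <= rho. *)
Lemma y_recursion p : 0 < p -> p <= rho -> gamma + 2 * theta * p = 1 + p ->
  y t.+1 <= y t
    - m * alpha / (2 * c ^+ 2) * tau t `^ (- gamma) * y t `^ (2 * theta)
    + m * alpha * Cu `^ (2 * theta) / c ^+ 2 * tau t `^ (- (p + 1)).
Proof.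
move=> p0 prho gp.
have H1 : y t `^ (2 * theta) <= 2 * c ^+ 2 * g t ^+ 2 + 2 * u t `^ (2 * theta).
  rewrite mulrC !powRrM !powR_mulrn ?powR_ge0//.
  apply: (@le_trans _ _ ((c * g t + u t `^ theta) ^+ 2)).
    rewrite ler_pXn2r ?nnegrE ?powR_ge0 ?addr_ge0 ?powR_ge0//.
    by rewrite mulr_ge0// ltW.
  by have := sqr_ge0 (c * g t - u t `^ theta); nra.
have H2 : tau t `^ (- gamma) * u t `^ (2 * theta) <=
   Cu `^ (2 * theta) * tau t `^ (- (p + 1)).
  rewrite uE mulrCA ler_wpM2l ?powR_ge0//.
  rewrite -powRD ?(gt_eqF (tau_gt0 t)) ?implybT//.
  rewrite ler_powR//; have : theta * p <= theta * rho by rewrite ler_pM2l.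
  lra.
have := y_descent T1t.
have c2 : 0 < c ^+ 2 by rewrite exprn_gt0.
have ma0 : 0 <= m * alpha := mulr_ge0 (ltW m_gt0) (ltW alpha_gt0).
have mc : 0 <= m * alpha / (2 * c ^+ 2).
  exact: divr_ge0 ma0 (mulr_ge0 (ler0n _ 2) (ltW c2)).
have H3 := ler_wpM2l (mulr_ge0 mc (powR_ge0 (tau t) (- gamma))) H1.
have mc' : 0 <= m * alpha / c ^+ 2 by exact: divr_ge0 ma0 (ltW c2).
have {mc'} H4 := ler_wpM2l mc' H2.
have E1 : m * alpha / (2 * c ^+ 2) * tau t `^ (- gamma) *
    (2 * c ^+ 2 * g t ^+ 2 + 2 * u t `^ (2 * theta)) =
    m * a t * g t ^+ 2 +
    m * alpha / c ^+ 2 * (tau t `^ (- gamma) * u t `^ (2 * theta)).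
  by rewrite /a; field; rewrite gt_eqF.
have E2 : m * alpha / c ^+ 2 * (Cu `^ (2 * theta) * tau t `^ (- (p + 1))) =
    m * alpha * Cu `^ (2 * theta) / c ^+ 2 * tau t `^ (- (p + 1)).
  by rewrite !mulrA; congr (_ * _); rewrite mulrAC.
move: H3 H4; rewrite E1 E2.
set P := m * a t * _; set Q := _ * (tau t `^ _ * _).
set S := _ * tau t `^ (- (p + 1)).
set V := _ * y t `^ _; lra.
Qed.

End KLBound.
End Exponent.

Lemma trajectory_cvg (theta0 c : R) : KL_exponent_constant f xbar theta0 c ->
  forall e, 0 < e -> exists S, forall t, (S <= t)%N -> enorm (x t - xbar) < e.
Proof.
move=> KL; have [c0 /andP[th00 th01] _] := KL.
have gr : gamma / rho < 1.
  by rewrite ltr_pdivrMr// mul1r; move: gamma_gt; rewrite /rho; lra.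
have gr0 : 0 < gamma / rho by rewrite divr_gt0//; move: gamma_gt; lra.
(* The least exponent above [theta0] that satisfies gamma <= theta rho; it stays below 1 because
   gamma > 1/2 gives gamma < rho. *)
pose theta := Num.max theta0 (gamma / rho).
have th1 : theta < 1 by rewrite gt_max th01 gr.
have thr : gamma <= theta * rho by rewrite -ler_pdivrMr// le_max lexx orbT.
have th0 : 0 < theta by rewrite lt_max gr0 orbT.
have tht : theta0 <= theta < 1 by rewrite th1 le_max lexx.
have [r r0 Hr] := KL_raise_exponent cont_f KL tht th0.
apply: (@trapped_cvg _ _ x xbar (residual_length theta c) r T1) => //.
- by move=> t _; exact: residual_length_ge0.
- by move=> t Tt xr; apply: step_le_residual_length => //; exact: Hr.
- exact: residual_length_cvg0.
Qed.

Hypothesis x_cvg : forall e, 0 < e ->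
  exists S, forall t, (S <= t)%N -> enorm (x t - xbar) < e.

(** The distance is at most [residual_length], and [powR_recursion_decay] with q = 2 theta gives y =
    O(tau^(-p)) for its first term. *)
Lemma trajectory_rate (theta0 c theta p : R) :
  KL_exponent_constant f xbar theta0 c -> theta0 <= theta < 1 ->
  gamma <= theta * rho -> 0 < p -> p <= rho -> gamma + 2 * theta * p = 1 + p ->
  1 <= 2 * theta -> (1 < 2 * theta \/ p < m * alpha / (2 * c ^+ 2)) ->
  exists K S, forall t, (S <= t)%N ->
    enorm (x t - xbar) <= K * tau t `^ (- (p * (1 - theta))).
Proof.
move=> KL tht thr p0 prho gp th2 thp; have [c0 _ _] := KL.
have /andP[_ th1] := tht.
have th0 : 0 < theta by lra.
have [r r0 Hr] := KL_raise_exponent cont_f KL tht th0.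
have [S1 HS1] : exists S, forall t, (S <= t)%N ->
    enorm (x t - xbar) <= residual_length theta c t.
  apply: (@trapped_rate _ _ x xbar (residual_length theta c) r T1) => //.
  - by move=> t _; exact: residual_length_ge0.
  - by move=> t Tt xr; apply: step_le_residual_length => //; exact: Hr.
  - exact: residual_length_cvg0.
have [S2 HS2] := x_cvg r0.
have t00 : 0 < t0 by exact: lt_le_trans t0_ge1.
have c2 : 0 < c ^+ 2 by rewrite exprn_gt0.
have ma0 : 0 < m * alpha by exact: mulr_gt0.
have e0 : 0 <= m * alpha * Cu `^ (2 * theta) / c ^+ 2.
  exact: divr_ge0 (mulr_ge0 (ltW ma0) (powR_ge0 _ _)) (ltW c2).
have b0 : 0 < m * alpha / (2 * c ^+ 2).
  exact: divr_gt0 ma0 (mulr_gt0 (ltr0n _ 2) c2).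
have [|||A A0 [S3 HS3]] := @powR_recursion_decay R y t0 p (2 * theta) gamma _ _
   (maxn T1 S2) t00 p0 e0 b0 gp th2 thp.
- by move=> t; rewrite geq_max => /andP[Tt _]; exact: y_ge0.
- by move=> t; rewrite geq_max => /andP[Tt _]; exact: (y_nonincr 1 Tt).
- move=> t; rewrite geq_max => /andP[Tt St].
  by apply: y_recursion => //; apply/Hr/HS2.
pose K1 := nu * ((c + 1) / (m * (1 - theta))).
pose K2 := (nu * (alpha * Cu `^ theta) + D * alpha ^+ 2) *
  ((2 * gamma - 1) * 2 `^ (- (2 * gamma - 1 + 1)))^-1.
exists (K1 * A `^ (1 - theta) + K2), (maxn T1 (maxn S1 S3)) => t.
rewrite !geq_max => /and3P[Tt St1 St3].
apply: (le_trans (HS1 _ St1)); rewrite mulrDl.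
have th1' : 0 <= 1 - theta by rewrite subr_ge0 ltW.
have K10 : 0 <= K1.
  exact: mulr_ge0 (ltW nu_gt0)
    (divr_ge0 (addr_ge0 (ltW c0) ler01) (mulr_ge0 (ltW m_gt0) th1')).
have K20 : 0 <= K2.
  apply: mulr_ge0.
    exact: addr_ge0
      (mulr_ge0 (ltW nu_gt0) (mulr_ge0 (ltW alpha_gt0) (powR_ge0 _ _)))
      (mulr_ge0 (ltW D_gt0) (exprn_ge0 _ (ltW alpha_gt0))).
  by rewrite invr_ge0 mulr_ge0 ?powR_ge0//; move: gamma_gt; lra.
apply: lerD.
  rewrite -[leRHS]mulrA; apply: ler_wpM2l => //.
  have -> : tau t `^ (- (p * (1 - theta))) = (tau t `^ (- p)) `^ (1 - theta).
    by rewrite -powRrM mulNr.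
  rewrite -powRM ?powR_ge0//.
  by rewrite ge0_ler_powR ?nnegrE ?mulr_ge0 ?powR_ge0 ?y_ge0 ?HS3.
apply: ler_wpM2l => //; rewrite ler_powR// lerN2.
(* The balance equation yields p (1 - theta) = (p + gamma - 1) / 2, which is at most 2 gamma - 1
   since p <= 3 gamma - 1. *)
move: prho gp; rewrite /rho; lra.
Qed.

(* Otherwise [y] would drop by at least [k / tau t] at every late step, so
   that [y t + k ln (tau t)] would be nonincreasing. *)
Lemma trajectory_limit_critical (L : R) :
  0 < L -> grad_lipschitz L f -> crit f xbar.
Proof.
move=> L0 lip; apply: enorm_eq0; apply/le_anti; rewrite enorm_ge0 andbT leNgt.
apply/negP => G0; set d := enorm (grad f xbar) / 2.
have d0 : 0 < d by rewrite divr_gt0.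
have [S HS] := x_cvg (divr_gt0 d0 L0).
pose T := maxn T1 S; pose k := m * alpha * d ^+ 2.
have k0 : 0 < k by exact: mulr_gt0 (mulr_gt0 m_gt0 alpha_gt0) (exprn_gt0 _ d0).
have H t : (T <= t)%N -> y t.+1 + k * ln (tau t.+1) <= y t + k * ln (tau t).
  rewrite geq_max => /andP[Tt St].
  have gd : d <= g t.
    have := enorm_sub_ge (grad f xbar) (grad f (x t)).
    have := lip xbar (x t).
    have : L * enorm (xbar - x t) <= d.
      by rewrite mulrC -ler_pdivlMr// enormBC ltW// HS.
    rewrite -/(g t) /d; lra.
  have lnle : ln (tau t.+1) - ln (tau t) <= (tau t)^-1.
    rewrite -ln_div ?posrE// tauS.
    have -> : (tau t + 1) / tau t = 1 + (tau t)^-1.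
      by field; rewrite gt_eqF.
    by apply: le_ln1Dx; rewrite (lt_trans _ (_ : 0 < _)) ?invr_gt0// oppr_lt0.
  have tg : (tau t)^-1 <= tau t `^ (- gamma).
    by rewrite -powR_inv1 ?(ltW (tau_gt0 t))// ler_powR// lerN2.
  have : k * (tau t)^-1 <= m * a t * g t ^+ 2.
    apply: (@le_trans _ _ (k * tau t `^ (- gamma))).
      by apply: ler_wpM2l => //; exact: ltW.
    have -> : k * tau t `^ (- gamma) = m * a t * d ^+ 2 by rewrite /k /a; ring.
    apply: ler_wpM2l; first by exact: mulr_ge0 (ltW m_gt0) (ltW (a_gt0 _)).
    by rewrite ler_pXn2r ?nnegrE ?(ltW d0).
  have := ler_wpM2l (ltW k0) lnle; have := y_descent Tt; rewrite mulrBr.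
  set w := m * _ * _; lra.
have {}H i : y (i + T)%N + k * ln (tau (i + T)%N) <= y T + k * ln (tau T).
  elim: i => [//|i IH]; apply: le_trans IH; apply: H; exact: leq_addl.
(* Once ln (tau t) exceeds [B], the monotone quantity would force y t < 0. *)
pose B := (y T + k * ln (tau T)) / k.
have := H (Num.truncn (expR B)).+1; set t := (_ + T)%N.
apply/negP; rewrite -ltNge.
have Bt : expR B < tau t.
  apply: (lt_le_trans (truncnS_gt _)).
  apply: (@le_trans _ _ t%:R); first by rewrite ler_nat leq_addr.
  by rewrite lerDl (le_trans ler01).
have : B < ln (tau t) by rewrite -[B]expRK ltr_ln ?posrE ?expR_gt0.
rewrite /B ltr_pdivrMr// mulrC.
have := y_ge0 (leq_trans (leq_maxl T1 S) (leq_addl _ _) : (T1 <= t)%N).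
lra.
Qed.

End Trajectory.

(** * Cluster points and convergent subsequences *)

Section Accumulation.
Context {R : realType} {n : nat}.
Implicit Types (x : nat -> 'rV[R]_n) (l : 'rV[R]_n).

Lemma bounded_seq_cluster x (M : R) : (forall t, `|x t| <= M) ->
  exists l, forall (e : R) S, 0 < e -> exists2 t, (S <= t)%N & `|x t - l| < e.
Proof.
move=> xM; pose A := [set z : 'rV[R]_n | `|z| <= M].
have cA : compact A.
  apply: bounded_closed_compact.
    exists M; split; first exact: num_real.
    by move=> r Mr z /le_trans; apply; exact: ltW.
  have -> : A = (fun z : 'rV[R]_n => `|z|) @^-1` [set r | r <= M] by [].
  apply: closed_comp; last exact: closed_le.
  by move=> z _; exact: norm_continuous.
have xA : (x @ \oo) A by exists 0%N => // t _; exact: xM.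
have [l [_ lx]] := cA (x @ \oo) _ xA.
exists l => e S e0.
have xS : (x @ \oo) [set z | exists2 t, (S <= t)%N & z = x t].
  by exists S => // t /= St; exists t.
have lB : nbhs l [set z | `|z - l| < e].
  apply/(@nbhs_normP _ 'rV[R]_n); exists e => //= z; by rewrite /= distrC.
by have [_ [[t St ->] ?]] := lx _ _ xS lB; exists t.
Qed.

Lemma cluster_accumulation_point x l :
  (forall (e : R) S, 0 < e -> exists2 t, (S <= t)%N & `|x t - l| < e) ->
  accumulation_points x l.
Proof.
(* Given stage k and the previous index S, [h] picks a strictly later index within 1 / (k + 1) of
   [l]; iterating it gives an increasing subsequence. *)
move=> H; have /choice[h Hh] : forall kS : nat * nat, exists t,
    (kS.2 < t)%N /\ `|x t - l| < kS.1.+1%:R^-1.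
  move=> [k S]; have k0 : 0 < k.+1%:R^-1 :> R by rewrite invr_gt0.
  by have [t] := H _ S.+1 k0; exists t.
pose tl := nat_rect (fun=> nat) (h (0%N, 0%N)) (fun k p => h (k.+1, p)).
exists tl; split.
  apply: homo_ltn => [? ? ?|k]; first exact: ltn_trans.
  by have [] := Hh (k.+1, tl k).
apply/cvgrPdist_lt => e e0; near=> k.
rewrite distrC; apply: (@lt_trans _ _ k.+1%:R^-1).
  by case: (k) => [|j] /=;
    [have [] := Hh (0%N, 0%N)|have [] := Hh (j.+1, tl j)].
by near: k; exact: near_infty_natSinv_lt (PosNum e0).
Unshelve. all: by end_near. Qed.

End Accumulation.

(** * Measurability of convergence events *)

Section FiniteDependence.
Variable N : nat.

(** Induction on [t]: split [A] over the finitely many values of the last relevant draw; with that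
    draw frozen, the section depends on one draw fewer. *)
Lemma measurable_finitely_determined t (A : set (Omega N)) :
  (forall w w', (forall k, (k < t)%N -> w k = w' k) -> A w -> A w') ->
  measurable A.
Proof.
elim: t A => [|t IH] A HA.
  have [[w Aw]|nA] := pselect (exists w, A w).
    have -> : A = setT by apply/seteqP; split=> // w' _; exact: HA Aw.
    exact: measurableT.
  have -> : A = set0 by apply/seteqP; split=> // w Aw; case: nA; exists w.
  exact: measurable0.
pose upd (s : 'S_N) (w : Omega N) : Omega N :=
  fun k => if k == t then s else w k.
have -> : A = \bigcup_(s in [set: 'S_N])
    ([set w : Omega N | [set s] (w t)] `&` [set w | A (upd s w)]).
  apply/seteqP; split=> [w Aw|w [s _ [/= ws]]].
    exists (w t) => //; split=> //=; apply: HA Aw => k _.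
    by rewrite /upd; case: eqP => // ->.
  by apply: HA => k _; rewrite /upd; case: eqP => // ->.
apply: fin_bigcup_measurable => [|s _]; first exact: finite_finset.
 apply: measurableI.
  by apply: sub_sigma_algebra; exists t => //; exists [set s].
apply: IH => w w' ww'; apply: HA => k; rewrite ltnS leq_eqVlt /upd.
by case: eqP => //= _; exact: ww'.
Qed.

Context {R : realType} {n : nat}.
Variable X : nat -> Omega N -> 'rV[R]_n.
Hypothesis X_determined : forall t w w', (forall k, (k < t)%N -> w k = w' k) ->
  X t w = X t w'.

(** The Cauchy criterion together with approach to [F] is a countable combination of events that
    depend on finitely many draws. Completeness provides the limit and closedness puts it in [F]. *)
Lemma measurable_cvg_to_closed (F : set 'rV[R]_n) : closed F ->
  measurable [set w | exists2 l, F l & X t w @[t --> \oo] --> l].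
Proof.
move=> cF.
have -> : [set w | exists2 l, F l & X t w @[t --> \oo] --> l] =
    \bigcap_k \bigcup_T \bigcap_s [set w |
      `|X T w - X (T + s)%N w| < k.+1%:R^-1 /\
      exists2 z, F z & `|z - X (T + s)%N w| < k.+1%:R^-1].
  apply/seteqP; split=> [w [l Fl Xl] k _|w H].
    have e0 : 0 < k.+1%:R^-1 / 2 :> R by rewrite divr_gt0.
    have /cvgrPdist_lt/(_ _ e0)[T _ HT] := Xl.
    exists T => // s _; have HTs := HT (T + s)%N (leq_addr _ _).
    split; last first.
      exists l => //; rewrite (lt_le_trans HTs)// ler_pdivrMr//.
      by rewrite ler_peMr// ler1n.
    rewrite [ltRHS]splitr -(subrK l (X T w)) -addrA.
    rewrite (le_lt_trans (ler_normD _ _))//.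
    by rewrite ltrD//; rewrite distrC; apply: HT => /=.
  have cX : cvg (X t w @[t --> \oo]).
    apply/cauchy_cvgP/cauchy_ballP => e e0; near \oo => k.
    have [T _ HT] := H k I.
    have ke : k.+1%:R^-1 < e / 2.
      by near: k; apply: (near_infty_natSinv_lt (PosNum _)); rewrite divr_gt0.
    pose B := [set z | `|X T w - z| < k.+1%:R^-1].
    exists (B, B).
      split; exists T => // t /= Tt; rewrite -(subnKC Tt).
        by have [] := HT (t - T)%N I.
      by have [] := HT (t - T)%N I.
    move=> [z1 z2] /= [h1 h2]; rewrite -ball_normE /ball_/=.
    rewrite [ltRHS]splitr -(subrK (X T w) z1) -addrA.
    rewrite (le_lt_trans (ler_normD _ _))//.
    by rewrite ltrD// ?(lt_trans _ ke)// distrC.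
  exists (lim (X t w @[t --> \oo])) => //; apply: cF => B.
  move=> /nbhs_normP[e /= e0 eB].
  near \oo => k; have [T _ HT] := H k I.
  have ke : k.+1%:R^-1 < e / 2.
    by near: k; apply: (near_infty_natSinv_lt (PosNum _)); rewrite divr_gt0.
  have /cvgrPdist_lt/(_ _ (divr_gt0 e0 (ltr0n _ 2)))[S _ HS] := cX.
  have [_ [z Fz Hz]] := HT S I.
  exists z; split=> //; apply: eB => /=.
  rewrite [ltRHS]splitr -(subrK (X (T + S)%N w) (lim _)) -addrA.
  rewrite (le_lt_trans (ler_normD _ _))// ltrD//.
    by apply: HS; exact: leq_addl.
  by rewrite distrC (lt_trans Hz).
apply: bigcapT_measurable => k; apply: bigcupT_measurable => T.
apply: bigcapT_measurable => s.
apply: (@measurable_finitely_determined (T + s)) => w w' ww' /=.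
rewrite -(X_determined ww') -(@X_determined T w w')// => j jT.
by apply: ww'; rewrite ltn_addr.
Unshelve. all: by end_near. Qed.

End FiniteDependence.

(** * Pathwise results for random reshuffling *)

Section Reshuffling.
Context {R : realType} {n N : nat}.
Variables (fi : 'I_N -> 'rV[R]_n -> R) (L alpha beta gamma : R).
Hypotheses (N_gt0 : (0 < N)%N) (L_gt0 : 0 < L).
Hypothesis dfi : forall i x, differentiable (fi i) x.
Hypothesis lipfi : forall i, grad_lipschitz L (fi i).
Hypotheses (alpha_gt0 : 0 < alpha) (beta_ge0 : 0 <= beta).
Hypothesis gamma_bounds : 2^-1 < gamma <= 1.
Let f := average fi.

Variables (x : nat -> 'rV[R]_n) (s : nat -> 'S_N) (M : R).
Hypothesis xS : forall t,
  x t.+1 = epoch fi (step_size alpha beta gamma t.+1) (s t) (x t).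
Hypothesis x_bounded : forall t, enorm (x t) <= M.

(** The step from [x t] uses index t + 1, so its base is t + 1 + beta, which is at least 1 even for
    beta = 0. *)
Let t0 : R := 1 + beta.
Let t0_ge1 : 1 <= t0. Proof. by rewrite lerDl. Qed.
Let gamma_gt0 : 0 < gamma.
Proof. by move: gamma_bounds => /andP[]; lra. Qed.

Let stepE t :
  step_size alpha beta gamma t.+1 = alpha * (t%:R + t0) `^ (- gamma).
Proof. by rewrite /step_size powRN -natr1 addrA. Qed.

Let tau_ge1 t : 1 <= t%:R + t0.
Proof. by rewrite (le_trans t0_ge1)// lerDr. Qed.

Let step_gt0 t : 0 < alpha * (t%:R + t0) `^ (- gamma).
Proof. by rewrite mulr_gt0// powR_gt0// (lt_le_trans _ (tau_ge1 t)). Qed.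

Let step_small e : 0 < e -> exists S, forall t, (S <= t)%N ->
  alpha * (t%:R + t0) `^ (- gamma) < e.
Proof.
move=> e0; have ea : 0 < e / alpha by rewrite divr_gt0.
have [S HS] := powRN_shift_cvg0 (le_trans ler01 t0_ge1) gamma_gt0 ea.
by exists S => t St; rewrite mulrC -ltr_pdivlMr// HS.
Qed.

(** [C] and [D] serve all times because a_t <= alpha and the path stays in the ball of radius [M];
    from [T1] on, 8 L N a_t <= 1. *)
Let trajectory_bounds : exists (C D : R) (T1 : nat), [/\ 0 < C, 0 < D,
  (forall t, enorm (x t.+1 - x t) <=
     N%:R * (alpha * (t%:R + t0) `^ (- gamma) * enorm (grad f (x t)))
     + D * (alpha * (t%:R + t0) `^ (- gamma)) ^+ 2) &
  (forall t, (T1 <= t)%N -> f (x t.+1) <= f (x t)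
     - N%:R / 2 * (alpha * (t%:R + t0) `^ (- gamma)) * enorm (grad f (x t)) ^+ 2
     + C * (alpha * (t%:R + t0) `^ (- gamma)) ^+ 3)].
Proof.
have [C [D [C0 D0 H]]] := epoch_descent N_gt0 L_gt0 dfi lipfi M alpha_gt0.
have small0 : 0 < 8 * L * N%:R.
  by rewrite mulr_gt0 ?ltr0n// mulr_gt0.
have [T1 HT1] : exists S, forall t, (S <= t)%N ->
    alpha * (t%:R + t0) `^ (- gamma) < (8 * L * N%:R)^-1.
  by apply: step_small; rewrite invr_gt0.
have aal t : 0 <= alpha * (t%:R + t0) `^ (- gamma) <= alpha.
  rewrite (ltW (step_gt0 t))/= ler_piMr ?(ltW alpha_gt0)//.
  rewrite -[leRHS](powRr0 (t%:R + t0)); apply: ler_powR => //.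
  by rewrite oppr_le0 ltW.
exists C, D, T1; split=> // t.
  by rewrite xS stepE; have [] := H _ (s t) _ (aal t) (x_bounded t).
move=> Tt; rewrite xS stepE.
have [_] := H _ (s t) _ (aal t) (x_bounded t); apply.
by have := HT1 _ Tt; rewrite -[ltRHS]mulr1 ltr_pdivlMl// => /ltW.
Qed.

Let f_continuous : continuous f.
Proof. by move=> z; exact/differentiable_continuous/differentiable_average. Qed.

Let half_N_gt0 : 0 < N%:R / 2 :> R. Proof. by rewrite divr_gt0// ltr0n. Qed.

Let enorm_cvg (l : 'rV[R]_n) :
  (forall e, 0 < e -> exists S, forall t, (S <= t)%N -> enorm (x t - l) < e) <->
  x t @[t --> \oo] --> l.
Proof.
split=> [H|/cvgrPdist_lt H e e0].
  apply/cvgrPdist_lt => e /H[S HS]; exists S => // t /HS; rewrite distrC.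
  by apply: le_lt_trans; exact: norm_le_enorm.
have n0 : 0 < n%:R + 1 :> R by rewrite ltr_wpDl.
have [S _ HS] := H _ (divr_gt0 e0 n0).
by exists S => t /HS; rewrite distrC; exact: enorm_lt.
Qed.

Let norm_cluster_enorm (l : 'rV[R]_n) :
  (forall (e : R) S, 0 < e -> exists2 t, (S <= t)%N & `|x t - l| < e) ->
  forall (e : R) S, 0 < e -> exists2 t, (S <= t)%N & enorm (x t - l) < e.
Proof.
move=> H e S e0; have n0 : 0 < n%:R + 1 :> R by rewrite ltr_wpDl.
by have [t St Ht] := H _ S (divr_gt0 e0 n0); exists t => //; exact: enorm_lt.
Qed.

(** Compactness supplies one accumulation point; the KL inequality there makes it the limit. *)
Lemma reshuffling_cvg :
  (forall l, accumulation_points x l ->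
     exists theta c, KL_exponent_constant f l theta c) ->
  exists2 l, crit f l & x t @[t --> \oo] --> l.
Proof.
move=> KL; have [C [D [T1 [C0 D0 step_le descent_le]]]] := trajectory_bounds.
have [l Hl] := bounded_seq_cluster
  (fun t => le_trans (norm_le_enorm (x t)) (x_bounded t)).
have [theta [c KLl]] := KL l (cluster_accumulation_point Hl).
have {}Hl := norm_cluster_enorm Hl.
have xl := trajectory_cvg alpha_gt0 gamma_bounds t0_ge1 half_N_gt0
  (_ : 0 < N%:R) C0 D0 step_le descent_le Hl (f_continuous (x:=l)) KLl.
exists l; last by apply/enorm_cvg/xl; rewrite ltr0n.
apply: (trajectory_limit_critical alpha_gt0 gamma_bounds t0_ge1 half_N_gt0
  C0 descent_le Hl (f_continuous (x:=l)) _ L_gt0).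
  by apply: xl; rewrite ltr0n.
exact: grad_lipschitz_average.
Qed.

Lemma reshuffling_rate (l : 'rV[R]_n) (theta0 c theta p : R) :
  x t @[t --> \oo] --> l ->
  KL_exponent_constant f l theta0 c -> theta0 <= theta < 1 ->
  gamma <= theta * (3 * gamma - 1) -> 0 < p -> p <= 3 * gamma - 1 ->
  gamma + 2 * theta * p = 1 + p -> 1 <= 2 * theta ->
  (1 < 2 * theta \/ p < N%:R / 2 * alpha / (2 * c ^+ 2)) ->
  exists K S, forall t, (S <= t)%N ->
    t%:R `^ (p * (1 - theta)) * enorm (x t - l) <= K.
Proof.
move=> /enorm_cvg xl KL tht thr p0 prho gp th2 thp.
have [C [D [T1 [C0 D0 step_le descent_le]]]] := trajectory_bounds.
have N0 : 0 < N%:R :> R by rewrite ltr0n.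
have clu e S : 0 < e -> exists2 t, (S <= t)%N & enorm (x t - l) < e.
  by move=> /xl[S' H]; exists (maxn S S'); [exact: leq_maxl|apply/H/leq_maxr].
have [K [S H]] := trajectory_rate alpha_gt0 gamma_bounds t0_ge1 half_N_gt0
  N0 C0 D0 step_le descent_le clu (f_continuous (x:=l)) xl KL tht thr p0 prho gp
  th2 thp.
have P0 : 0 <= p * (1 - theta).
  by rewrite mulr_ge0 ?(ltW p0)// subr_ge0 ltW//; case/andP: tht.
exists K, S => t St; have tau0 := lt_le_trans ltr01 (tau_ge1 t).
have T0 : 0 < (t%:R + t0) `^ (p * (1 - theta)) by rewrite powR_gt0.
apply: (@le_trans _ _ ((t%:R + t0) `^ (p * (1 - theta)) * enorm (x t - l))).
  rewrite ler_wpM2r ?enorm_ge0// ge0_ler_powR ?nnegrE ?(ltW tau0)//.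
  by rewrite lerDl (le_trans ler01).
have := H _ St; rewrite powRN ler_pdivlMr//.
by rewrite mulrC.
Qed.

End Reshuffling.

(** * Limsup bounds, the cases of the rate, and the almost sure statement *)

Lemma limn_esup_lt_pinfty (R : realType) (u : R^nat) (K : R) (S : nat) :
  (forall t, (S <= t)%N -> u t <= K) -> (limn_esup (fun t => (u t)%:E) < +oo)%E.
Proof.
move=> H; apply: (@le_lt_trans _ _ K%:E); last exact: ltry.
rewrite /limn_esup /limf_esup.
pose V := [set t | (S <= t)%N].
apply: (@le_trans _ _ (ereal_sup ((fun t => (u t)%:E) @` V))).
  by apply: ereal_inf_lbound; exists V => //; exists S.
by apply: ge_ereal_sup => _ [t /= St <-]; rewrite lee_fin H.
Qed.

(* [th] is the exponent raised to at least [gamma / (3 gamma - 1)], below which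
   the noise dominates, and [p] is the decay rate of the function values. *)
Lemma rate_cases (R : realType) (N : nat) (alpha gamma theta c : R) :
  (0 < N)%N -> 0 < alpha -> 0 < c -> 2^-1 < gamma <= 1 -> 0 <= theta < 1 ->
  rate N alpha gamma theta c = 0 \/
  exists th p : R, rate N alpha gamma theta c = p * (1 - th) /\
    [/\ theta <= th < 1, gamma <= th * (3 * gamma - 1), 0 < p <= 3 * gamma - 1,
     gamma + 2 * th * p = 1 + p &
     1 <= 2 * th /\ (1 < 2 * th \/ p < N%:R / 2 * alpha / (2 * c ^+ 2))].
Proof.
move=> N0 al0 c0 /andP[g1 g2] /andP[th0 th1].
have rho0 : 0 < 3 * gamma - 1 by lra.
rewrite /rate th0 th1 g1 /=; have [g3|g3] := ltP gamma 1; last first.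
  have {g2 g3}-> : gamma = 1 by apply/le_anti; rewrite g2.
  rewrite !andbF eqxx /=; case: ifPn => [/andP[th2 ca]|_]; last by left.
  (* With th = 1/2 and p = 2 the rate p (1 - th) is 1, and p < N alpha / (4 c^2) is the threshold
     alpha > 8 c^2 / N. *)
  right; exists 2^-1, 2; split; first lra.
  split; [lra|lra|lra|lra|split; [lra|right]].
  have N0' : 0 < N%:R :> R by rewrite ltr0n.
  move: ca; rewrite ltr_pdivrMr// ltr_pdivlMr ?mulr_gt0 ?exprn_gt0//.
  set C := c ^+ 2; lra.
have [th2|th2] := ltP theta (gamma / (3 * gamma - 1)).
  right; exists (gamma / (3 * gamma - 1)), (3 * gamma - 1); rewrite /=.
  have gr : gamma / (3 * gamma - 1) < 1 by rewrite ltr_pdivrMr//; lra.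
  have gr2 : 1 < 2 * (gamma / (3 * gamma - 1)).
    by rewrite mulrA ltr_pdivlMr//; lra.
  split; first by field; rewrite gt_eqF.
  split.
  - by rewrite (ltW th2) gr.
  - by rewrite divfK// gt_eqF.
  - by rewrite rho0 lexx.
  - by field; rewrite gt_eqF.
  - by split; [exact: ltW|left].
right; move: (th2); rewrite ler_pdivrMr// => th3.
have th4 : 1 < 2 * theta.
  suff : 0 < (2 * theta - 1) * (3 * gamma - 1) by rewrite pmulr_lgt0//; lra.
  lra.
have q0 : 0 < 2 * theta - 1 by lra.
(* This p solves the balance equation for the unraised exponent. *)
exists theta, ((1 - gamma) / (2 * theta - 1)); split.
  by rewrite /= [in RHS]mulrAC [in RHS](mulrC (1 - gamma)).
split.
- by rewrite lexx.
- by [].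
- by rewrite divr_gt0 ?subr_gt0//= ler_pdivrMr//; lra.
- by field; rewrite gt_eqF.
- by split; [exact: ltW|left].
Qed.

Theorem theorem3p12 (R : realType) (n N : nat) (fi : 'I_N -> 'rV[R]_n -> R)
    (L alpha beta gamma : R) (x0 : 'rV[R]_n) (P : probability (Omega N) R)
    (K : set (Omega N)) :
  let f := average fi in
  let X := iterate fi (step_size alpha beta gamma) x0 in
  (0 < N)%N ->
  0 < L ->
  (forall i, [/\ C1 (fi i), bounded_from_below (fi i)
               & grad_lipschitz L (fi i)]) ->
  0 < alpha -> 0 <= beta -> 2^-1 < gamma <= 1 ->
  iid_uniform P ->
  {ae P, forall w,
    (ereal_sup [set (enorm (X t w))%:E | t in [set t | (1 <= t)%N]] < +oo)%E} ->
  measurable K -> P K = 1%E ->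
  (forall xbar, (\bigcup_(w in K) accumulation_points (X ^~ w)) xbar ->
    exists theta c, KL_exponent_constant f xbar theta c) ->
  exists Xstar : Omega N -> 'rV[R]_n,
    [/\ measurable_fun [set: Omega N]
          (Xstar : Omega N -> g_sigma_algebraType borel_rV),
        forall w, crit f (Xstar w),
        {ae P, forall w, X t w @[t --> \oo] --> Xstar w}
      & forall Theta C : Omega N -> R,
          (forall w, 0 <= Theta w < 1) ->
          (forall w, 0 <= C w) ->
          (forall w, K w -> X t w @[t --> \oo] --> Xstar w ->
             KL_exponent_constant f (Xstar w) (Theta w) (C w)) ->
          {ae P, forall w,
            (limn_esup (fun t => (t%:R `^ rate N alpha gamma (Theta w) (C w)
                                  * enorm (X t w - Xstar w))%:E) < +oo)%E}].
Proof.
move=> f X N0 L0 fiH al0 be0 ga iid bnd mK PK KL.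
have dfi i x : differentiable (fi i) x by have [[]] := fiH i.
have lipfi i : grad_lipschitz L (fi i) by have [] := fiH i.
have XS w t :
  X t.+1 w = epoch fi (step_size alpha beta gamma t.+1) (w t) (X t w) by [].
have bounded w :
    (ereal_sup [set (enorm (X t w))%:E | t in [set t | (1 <= t)%N]] < +oo)%E ->
    exists M, forall t, enorm (X t w) <= M.
  move=> sup_lt; set E := ereal_sup _ in sup_lt.
  have Xle t : (1 <= t)%N -> ((enorm (X t w))%:E <= E)%E.
    by move=> t1; apply: ereal_sup_ubound; exists t.
  have E_fin : E \is a fin_num.
    by rewrite ge0_fin_numE// (le_trans _ (Xle 1%N _))// lee_fin enorm_ge0.
  (* The supremum starts at t = 1, so the initial point is added by hand. *)
  exists (Num.max (enorm (X 0%N w)) (fine E)) => -[|t].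
    by rewrite le_max lexx.
  by rewrite le_max; apply/orP; right; rewrite -lee_fin fineK// Xle.
have aeK : {ae P, forall w, K w}.
  exists (~` K); split=> //; first exact: measurableC.
  by rewrite probability_setC// PK subee.
pose limit_in (F : set 'rV[R]_n) : set (Omega N) :=
  [set w | exists2 l, F l & X t w @[t --> \oo] --> l].
have ae_cvg : {ae P, forall w, limit_in (crit f) w}.
  apply: filterS2 bnd aeK => w /bounded[M HM] Kw.
  apply: (reshuffling_cvg N0 L0 dfi lipfi al0 be0 ga (XS w) HM) => l xl.
  by apply: KL; exists w.
have [z0 z0_crit] : exists z0, crit f z0.
  have PP : ProperFilter (almost_everywhere P).
    have P0 : (0 < P setT)%E by rewrite probability_setT.
    exact: ae_properfilter_algebraOfSetsType P0.
  by have [w [l ? _]] := filter_ex ae_cvg; exists l.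
have /choice[Xstar HX] : forall w, exists z,
    (crit f z /\ X t w @[t --> \oo] --> z) \/ (~ limit_in (crit f) w /\ z = z0).
  move=> w; have [[l fl Xl]|nl] := pselect (limit_in (crit f) w).
    by exists l; left.
  by exists z0; right.
have Xstar_cvg w : limit_in (crit f) w -> X t w @[t --> \oo] --> Xstar w.
  by have [[]|[]] := HX w.
exists Xstar; split.
- apply: (@measurability _ _ (Omega N) (g_sigma_algebraType borel_rV) setT
    Xstar borel_rV) => // _ [U oU <-]; rewrite setTI.
  (* Only limits in closed sets give events known to be measurable, so a limit in the open [U] is
     expressed as a critical limit that is not in the closed set crit f minus U. *)
  have -> : Xstar @^-1` U = (limit_in (crit f) `\` limit_in (crit f `&` ~` U))
      `|` (~` limit_in (crit f) `&` [set _ | U z0]).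
    apply/seteqP; split=> [w /= Uw|w [[lw nU]|[nw /= Uz0]]] /=.
    + have [[Xc Xw]|[nw Xz0]] := HX w; last by right; split=> //; rewrite -Xz0.
      left; split; first by exists (Xstar w).
      move=> [l [_ nUl] Xl]; apply: nUl.
      by rewrite (cvg_unique _ Xl Xw).
    + apply: contrapT => nUw; apply: nU; have Xw := Xstar_cvg _ lw.
      by exists (Xstar w) => //; split=> //; have [[]|[_ ->]] := HX w.
    + by have [[Xc Xw]|[_ ->]] := HX w => //; case: nw; exists (Xstar w).
  have crit_closed : closed (crit f).
    have -> : crit f = grad f @^-1` [set 0] by [].
    apply: closed_comp => [z _|]; last first.
      apply: accessible_closed_set1; apply: hausdorff_accessible.
      exact: norm_hausdorff.
    apply: (grad_lipschitz_continuous (ltW L0)).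
    exact: grad_lipschitz_average.
  have X_determined t w w' : (forall k, (k < t)%N -> w k = w' k) ->
      X t w = X t w'.
    elim: t => [//|t IH] ww'; rewrite !XS ww'// IH// => k kt.
    by apply: ww'; rewrite ltnS ltnW.
  have mlim F : closed F -> measurable (limit_in F).
    by move=> cF; exact: (measurable_cvg_to_closed X_determined cF).
  apply: measurableU; first apply: measurableD; [exact: mlim| |].
    by apply: mlim; apply: closedI => //; exact: open_closedC.
  have [Uz0|nUz0] := pselect (U z0).
    have -> : [set _ | U z0] = [set: Omega N] by apply/seteqP; split.
    by rewrite setIT; apply: measurableC; exact: mlim.
  have -> : [set _ | U z0] = set0 :> set (Omega N) by apply/seteqP; split.
  by rewrite setI0; exact: measurable0.
- by move=> w; have [[]|[_ ->]] := HX w.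
- by apply: filterS ae_cvg => w /Xstar_cvg.
move=> Theta C Th01 C0 HKL.
apply: filterS3 bnd aeK ae_cvg => w /bounded[M HM] Kw /Xstar_cvg Xw.
have KLw := HKL w Kw Xw; have [c0 th01 _] := KLw.
have [->|[th [p [-> [tht thr /andP[p0 prho] gp [th2 thp]]]]]] :=
    rate_cases N0 al0 c0 ga th01.
  (* At rate 0 the weight t^0 is 1, and convergence alone bounds the distances eventually. *)
  have /cvgrPdist_lt/(_ _ ltr01)[S _ HS] := Xw.
  apply: (@limn_esup_lt_pinfty _ _ (n%:R * 1) S) => t St.
  rewrite powRr0 mul1r (le_trans (enorm_le_norm _))// ler_wpM2l//.
  by rewrite distrC ltW//; exact: HS.
have [K' [S HS]] := reshuffling_rate N0 L0 dfi lipfi al0 be0 ga (XS w) HM Xw KLw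
  tht thr p0 prho gp th2 thp.
exact: limn_esup_lt_pinfty HS.
Qed.
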